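(* Let $A$ be a $\mathbb{Q}$-domain, $K=\operatorname{frac}(A)$, $B=A^{[3]}$ and $D\in\operatorname{LND}_A(B)$. Let $(X,Y,Z)$ be a coordinate system of $B$ over $A$ such that $D(X)=0$. Assume that $\operatorname{rank} D=\operatorname{rank} D_K=2$, where $D_K$ is the extension of $D$ to $K^{[3]}$. Then $D$ is triangulable over $A$ if and only if $D$ is triangulable over $A[X]$.
   Context: $A^{[n]}$ denotes the polynomial ring in $n$ variables over $A$. A coordinate system of $B=A^{[n]}$ over $A$ is an $n$-tuple $(X_1,\dots,X_n)$ with $A[X_1,\dots,X_n]=B$. $\operatorname{LND}_A(B)$ is the set of locally nilpotent $A$-derivations of $B$. The rank of $D$ is the least $r\ge0$ such that some coordinate system $(X_1,\dots,X_n)$ of $B$ over $A$ has $A[X_1,\dots,X_{n-r}]\subset\ker D$ (similarly over $K$ for $D_K$). For a subring $R\supseteq A$ with $B=R^{[m]}$, $D$ is triangulable over $R$ if there is a coordinate system $(Y_1,\dots,Y_m)$ of $B$ over $R$ with $D(Y_i)\in R[Y_1,\dots,Y_{i-1}]$ for all $i$; here $B=A[X]^{[2]}$ since $B=A[X][Y,Z]$. *)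

(* Defs.v *)
From HB Require Import structures.
From mathcomp Require Import all_boot all_order all_algebra.
Set Implicit Arguments. Unset Strict Implicit. Unset Printing Implicit Defensive.
Import GRing.Theory.
Local Open Scope ring_scope.

Definition poly3 (R : nzRingType) := {poly {poly {poly R}}}.

Definition cst3 (R : nzRingType) (a : R) : {poly {poly {poly R}}} := a%:P%:P%:P.

Definition inBase3 (R : nzRingType) (b : {poly {poly {poly R}}}) : Prop :=
  exists a : R, b = cst3 a.

(* gen S xs b : b lies in the subring S[x_1,...,x_n] generated by the
   subring S (given as a predicate, assumed to contain 1) and the x_i. *)
Inductive gen (T : comNzRingType) (S : T -> Prop) (xs : seq T) : T -> Prop :=
| gen_base a : S a -> gen S xs a
| gen_var x : x \in xs -> gen S xs x
| gen_add a b : gen S xs a -> gen S xs b -> gen S xs (a + b)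
| gen_opp a : gen S xs a -> gen S xs (- a)
| gen_mul a b : gen S xs a -> gen S xs b -> gen S xs (a * b).

Definition coord_sys (T : comNzRingType) (S : T -> Prop) (n : nat) (xs : seq T)
  : Prop := size xs = n /\ forall b : T, gen S xs b.

Definition is_derivation (T : comNzRingType) (S : T -> Prop) (D : T -> T) : Prop :=
  [/\ forall a b, D (a + b) = D a + D b,
      forall a b, D (a * b) = a * D b + b * D a
    & forall a, S a -> D a = 0].

Definition is_LND (T : comNzRingType) (S : T -> Prop) (D : T -> T) : Prop :=
  is_derivation S D /\ forall b, exists m : nat, iter m D b = 0.

Definition rank_le (T : comNzRingType) (S : T -> Prop) (n : nat) (D : T -> T)
  (r : nat) : Prop :=
  exists xs, coord_sys S n xs /\
    forall b, gen S (take (n - r) xs) b -> D b = 0.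

Definition rank_eq (T : comNzRingType) (S : T -> Prop) (n : nat) (D : T -> T)
  (r : nat) : Prop :=
  rank_le S n D r /\ forall r', (r' < r)%N -> ~ rank_le S n D r'.

(* D triangulable over S (with T = S^[m]): a coordinate system (y_1..y_m)
   of T over S with D(y_i) ∈ S[y_1..y_{i-1}]  (0-based: index i, take i). *)
Definition triangulable (T : comNzRingType) (S : T -> Prop) (m : nat)
  (D : T -> T) : Prop :=
  exists ys, coord_sys S m ys /\
    forall i, (i < m)%N -> gen S (take i ys) (D (nth 0 ys i)).

Definition frac3 (A : idomainType) (p : {poly {poly {poly A}}})
  : {poly {poly {poly {fraction A}}}} :=
  map_poly (map_poly (map_poly (@tofrac A))) p.

(* Main.v *)
(** Over the fraction field, write the triangular system as (x, y, z), with
    D x = c, D y = f(x), D z = g(x, y), and let u be the image of X.  If c <> 0,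
    integrating along x shows that the rank is at most 1; the same holds if
    c = f = 0.  Otherwise let P = a(x) z + b(x, y) be a kernel element with
    a <> 0 of least degree, so that b(l, y) is not constant at any root l of a,
    and replace D by D' = a d/dy - b_y d/dz, whose kernel is K[x, P].

    If for every root l of a the polynomial b(l, y) is linear, then D' has a
    slice s and (x, P, s) is a coordinate system, so D has rank at most 1.  If
    b(l, y) has degree at least 2 for some root l (in an extension of K), then
    every coordinate u in K[x, P] lies in K[x].  Indeed suppose not and let C be
    the quotient of K[x, y, z] by u - m, where m = u(l, 0, z): it is a polynomial
    ring in two variables, in which the ideal of the line x = l, y = 0 is
    principal, say (q).  As q divides x - l, it is killed by D', hence, up to a
    denominator not vanishing at l, it comes from K[x, P]; on x = l it is
    therefore divisible by b(l, y) - b(l, 0), and so would be y.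

    Rank 2 thus forces u in K[x], and the corresponding statement over A gives
    A[X] = A[x]. *)
Require Import Defs.
From HB Require Import structures.
From mathcomp Require Import all_boot all_order all_algebra all_field.
From mathcomp Require Import ring.
From Stdlib Require Import Classical_Prop.
Set Implicit Arguments. Unset Strict Implicit. Unset Printing Implicit Defensive.
Import GRing.Theory.
Local Open Scope ring_scope.

(** * Generated subrings and evaluation morphisms *)

Lemma gen_sub (T : comNzRingType) (S S' : T -> Prop) (xs ys : seq T) :
  (forall a, S a -> gen S' ys a) -> (forall x, x \in xs -> gen S' ys x) ->
  forall b, gen S xs b -> gen S' ys b.
Proof.
move=> hS hx b; elim=> [a /hS|x /hx| a c _ ? _ ?|a _ ?|a c _ ? _ ?] //.
- exact: gen_add.
- exact: gen_opp.
- exact: gen_mul.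
Qed.

Lemma gen_gen (T : comNzRingType) (S : T -> Prop) (xs ys : seq T) b :
  gen (gen S xs) ys b <-> gen S (xs ++ ys) b.
Proof.
split; apply: gen_sub => [a Sa|x].
- apply: gen_sub a Sa => [a|x] h; first exact: gen_base.
  by apply: gen_var; rewrite mem_cat h.
- by move=> h; apply: gen_var; rewrite mem_cat h orbT.
- by apply/gen_base/gen_base.
- rewrite mem_cat => /orP[] h; last exact: gen_var.
  exact/gen_base/gen_var.
Qed.

Lemma gen_rmorph_im (R T : comNzRingType) (f : {rmorphism R -> T})
    (S : T -> Prop) (xs : seq T) :
  (forall a, S a -> exists r, a = f r) ->
  (forall x, x \in xs -> exists r, x = f r) ->
  forall b, gen S xs b -> exists r, b = f r.
Proof.
move=> hS hx b; elim=> [a /hS|x /hx| a c _ [r ->] _ [s ->]|a _ [r ->]|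
  a c _ [r ->] _ [s ->]] //.
- by exists (r + s); rewrite rmorphD.
- by exists (- r); rewrite rmorphN.
- by exists (r * s); rewrite rmorphM.
Qed.

Section Evaluation.

Definition ev1 (R T : comNzRingType) (f : {rmorphism R -> T}) (t : T) :
  {rmorphism {poly R} -> T} := horner_morph (fun x => mulrC t (f x)).

Arguments ev1 : simpl never.

Lemma ev1E (R T : comNzRingType) (f : {rmorphism R -> T}) t p :
  ev1 f t p = (map_poly f p).[t].
Proof. by []. Qed.

Lemma ev1C (R T : comNzRingType) (f : {rmorphism R -> T}) t c :
  ev1 f t c%:P = f c.
Proof. by rewrite ev1E map_polyC hornerC. Qed.

Lemma ev1X (R T : comNzRingType) (f : {rmorphism R -> T}) t :
  ev1 f t 'X = t.
Proof. by rewrite ev1E map_polyX hornerX. Qed.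

Lemma rmorph_ext (R T : comNzRingType) (f g : {rmorphism {poly R} -> T}) :
  (forall c, f c%:P = g c%:P) -> f 'X = g 'X -> f =1 g.
Proof.
move=> hC hX; elim/poly_ind => [|p c IH]; first by rewrite !rmorph0.
by rewrite !rmorphD !rmorphM IH hX hC.
Qed.

Lemma gen_ev1 (R T : comNzRingType) (f : {rmorphism R -> T}) (t : T)
    (S : T -> Prop) (xs : seq T) :
  (forall c, gen S xs (f c)) -> gen S xs t -> forall p, gen S xs (ev1 f t p).
Proof.
move=> hf ht; elim/poly_ind => [|p c IH].
  by rewrite rmorph0 -(rmorph0 f).
rewrite rmorphD rmorphM ev1X ev1C; apply: gen_add => //; exact: gen_mul.
Qed.

Lemma ev1_comp (R S T : comNzRingType) (f : {rmorphism R -> S}) t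
    (g : {rmorphism S -> T}) (h : {rmorphism R -> T}) :
  (forall c, g (f c) = h c) -> forall p, g (ev1 f t p) = ev1 h (g t) p.
Proof.
move=> gf; elim/poly_ind => [|p c IH]; first by rewrite !rmorph0.
by rewrite !rmorphD !rmorphM IH !ev1X !ev1C gf.
Qed.

Lemma ev1_map (R S T : comNzRingType) (f : {rmorphism S -> T}) t
    (g : {rmorphism R -> S}) (h : {rmorphism R -> T}) :
  (forall c, f (g c) = h c) -> forall p, ev1 f t (map_poly g p) = ev1 h t p.
Proof.
move=> fg; elim/poly_ind => [|p c IH]; first by rewrite !rmorph0.
by rewrite rmorphD rmorphM /= map_polyX map_polyC !rmorphD !rmorphM IH !ev1X !ev1C fg.
Qed.

Definition polyCC (R : comNzRingType) : {rmorphism R -> {poly {poly R}}} :=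
  polyC \o polyC.

Definition ev3 (K T : comNzRingType) (i : {rmorphism K -> T}) (x y z : T) :
  {rmorphism {poly {poly {poly K}}} -> T} := ev1 (ev1 (ev1 i x) y) z.

Arguments ev3 : simpl never.

Lemma ev3_ext (K T : comNzRingType) (f g : {rmorphism {poly {poly {poly K}}} -> T}) :
  (forall c, f c%:P%:P%:P = g c%:P%:P%:P) -> f 'X%:P%:P = g 'X%:P%:P ->
  f 'X%:P = g 'X%:P -> f 'X = g 'X -> f =1 g.
Proof.
move=> hc hx hy hz; apply: rmorph_ext hz => c.
apply: (@rmorph_ext _ _ (f \o polyC) (g \o polyC)) hy c => c /=.
exact: (@rmorph_ext _ _ (f \o polyC \o polyC) (g \o polyC \o polyC)).
Qed.

Lemma ev3C (K T : comNzRingType) (i : {rmorphism K -> T}) x y z c :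
  ev3 i x y z c%:P%:P%:P = i c.
Proof. by rewrite /ev3 !ev1C. Qed.
Lemma ev3X (K T : comNzRingType) (i : {rmorphism K -> T}) x y z :
  ev3 i x y z 'X%:P%:P = x.
Proof. by rewrite /ev3 !ev1C ev1X. Qed.
Lemma ev3Y (K T : comNzRingType) (i : {rmorphism K -> T}) x y z :
  ev3 i x y z 'X%:P = y.
Proof. by rewrite /ev3 !ev1C ev1X. Qed.
Lemma ev3Z (K T : comNzRingType) (i : {rmorphism K -> T}) x y z :
  ev3 i x y z 'X = z.
Proof. by rewrite /ev3 ev1X. Qed.

Definition iC (K : comNzRingType) : {rmorphism K -> {poly {poly {poly K}}}} :=
  polyC \o polyC \o polyC.

End Evaluation.

(** * Derivations along a morphism *)

(** [T] is an [R]-module through [f]. This covers [d \o e] and [e \o d] for a morphism [e], so that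
    such composites can be compared on generators. *)
Definition is_der (R T : comNzRingType) (f : R -> T) (d : R -> T) : Prop :=
  (forall a b, d (a + b) = d a + d b) /\
  (forall a b, d (a * b) = f a * d b + f b * d a).

Lemma ders0 (R T : comNzRingType) (f d : R -> T) : is_der f d -> d 0 = 0.
Proof. by case=> /(_ 0 0) + _; rewrite addr0 => /eqP; rewrite -subr_eq0 opprD addNKr oppr_eq0 => /eqP. Qed.

Lemma ders_ext (R T : comNzRingType) (f : {rmorphism {poly R} -> T}) d d' :
  is_der f d -> is_der f d' ->
  (forall c, d c%:P = d' c%:P) -> d 'X = d' 'X -> d =1 d'.
Proof.
move=> hd hd' hC hX; elim/poly_ind => [|p c IH]; first by rewrite (ders0 hd) (ders0 hd').
by case: hd hd' => [dD dM] [dD' dM']; rewrite dD dD' dM dM' IH hX hC.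
Qed.

Lemma ders3_ext (K T : comNzRingType) (f : {rmorphism {poly {poly {poly K}}} -> T})
    (d d' : {poly {poly {poly K}}} -> T) :
  is_der f d -> is_der f d' -> (forall c : K, d c%:P%:P%:P = d' c%:P%:P%:P) ->
  d 'X%:P%:P = d' 'X%:P%:P -> d 'X%:P = d' 'X%:P -> d 'X = d' 'X -> d =1 d'.
Proof.
move=> hd hd' hc hx hy hz.
have aux (R S : comNzRingType) (g : {rmorphism R -> S}) (h : S -> T) e :
    is_der h e -> is_der (h \o g) (e \o g).
  by move=> [eD eM]; split=> a b /=; rewrite ?rmorphD ?rmorphM ?eD ?eM.
have [h1 h1'] := (aux _ _ polyC _ _ hd, aux _ _ polyC _ _ hd').
have [h2 h2'] := (aux _ _ polyC _ _ h1, aux _ _ polyC _ _ h1').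
apply: ders_ext hd hd' _ hz => c.
apply: (@ders_ext _ _ (f \o polyC) (d \o polyC) (d' \o polyC) h1 h1') hy c => c /=.
exact: (@ders_ext _ _ (f \o polyC \o polyC) (d \o polyC \o polyC) _ h2 h2') hx c.
Qed.

Lemma ders_deriv (R : comNzRingType) : is_der id (@deriv R).
Proof. split=> a b; first exact: derivD. by rewrite derivM addrC [b * _]mulrC. Qed.

Lemma ders_map (R : comNzRingType) (d : R -> R) : is_der id d -> is_der id (map_poly d).
Proof.
move=> hd; have d0 := ders0 hd; case: hd => dD dM.
have dS I r (P : pred I) E : d (\sum_(i <- r | P i) E i) = \sum_(i <- r | P i) d (E i).
  exact: (big_morph d dD d0).
split=> a b; apply/polyP=> k.
  by rewrite coefD !coef_map_id0 // coefD dD.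
rewrite [b * _]mulrC coefD coef_map_id0 // !coefM dS -big_split /=.
by apply: eq_bigr => i _; rewrite dM !coef_map_id0 // [b`__ * _]mulrC.
Qed.

(** The outermost variable is z and the innermost x, so the derivative acts at depth 0, 1 and 2. *)
HB.lock Definition dz (K : comNzRingType) (p : {poly {poly {poly K}}}) :=
  p^`().
HB.lock Definition dy (K : comNzRingType) (p : {poly {poly {poly K}}}) :=
  map_poly (@deriv _) p.
HB.lock Definition dx (K : comNzRingType) (p : {poly {poly {poly K}}}) :=
  map_poly (map_poly (@deriv _)) p.

Lemma ders_eq (R T : comNzRingType) (f d d' : R -> T) :
  d =1 d' -> is_der f d' -> is_der f d.
Proof. by move=> E [dD dM]; split=> a b; rewrite !E. Qed.

Lemma ders_dz (K : comNzRingType) : is_der id (@dz K).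
Proof. by apply: ders_eq (ders_deriv _) => p; rewrite dz.unlock. Qed.
Lemma ders_dy (K : comNzRingType) : is_der id (@dy K).
Proof. by apply: ders_eq (ders_map (ders_deriv _)) => p; rewrite dy.unlock. Qed.
Lemma ders_dx (K : comNzRingType) : is_der id (@dx K).
Proof.
by apply: ders_eq (ders_map (ders_map (ders_deriv _))) => p; rewrite dx.unlock.
Qed.

Lemma map_polyC0 (R S : nzRingType) (d : R -> S) c :
  d 0 = 0 -> map_poly d c%:P = (d c)%:P.
Proof.
move=> d0; apply/polyP=> i.
by rewrite coef_map_id0 // !coefC; case: eqP.
Qed.

Lemma map_polyX0 (R : nzRingType) (d : R -> R) :
  d 0 = 0 -> d 1 = 0 -> map_poly d 'X = 0.
Proof.
move=> d0 d1; apply/polyP=> i.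
by rewrite coef_map_id0 // coefX coef0; case: eqP.
Qed.

Section PartialsE.
Variable K : comNzRingType.

Lemma map_derivC (R : comNzRingType) (c : R) : map_poly (@deriv R) c%:P%:P = 0.
Proof. by rewrite map_polyC0 ?deriv0 // derivC. Qed.

Lemma map_deriv0 (R : comNzRingType) : map_poly (@deriv R) 0 = 0.
Proof. by have := map_derivC (0 : R); rewrite !polyC0. Qed.

Lemma map_deriv1 (R : comNzRingType) : map_poly (@deriv R) 1 = 0.
Proof. by have := map_derivC (1 : R); rewrite !polyC1. Qed.

Lemma dzC (c : {poly {poly K}}) : dz c%:P = 0.
Proof. by rewrite dz.unlock derivC. Qed.
Lemma dzZ : dz ('X : {poly {poly {poly K}}}) = 1.
Proof. by rewrite dz.unlock derivX. Qed.
Lemma dyC (c : {poly {poly K}}) : dy c%:P = (c^`())%:P.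
Proof. by rewrite dy.unlock map_polyC0 ?deriv0. Qed.
Lemma dyZ : dy ('X : {poly {poly {poly K}}}) = 0.
Proof.
rewrite dy.unlock; apply: map_polyX0; first exact: deriv0.
by rewrite -polyC1 derivC.
Qed.
Lemma dyY : dy ('X%:P : {poly {poly {poly K}}}) = 1.
Proof. by rewrite dyC derivX polyC1. Qed.
Lemma dxC (c : {poly K}) : dx c%:P%:P = (c^`())%:P%:P.
Proof.
rewrite dx.unlock map_polyC0 ?map_deriv0 // map_polyC0 //.
exact: deriv0.
Qed.
Lemma dxX : dx ('X%:P%:P : {poly {poly {poly K}}}) = 1.
Proof. by rewrite dxC derivX !polyC1. Qed.
Lemma dxY : dx ('X%:P : {poly {poly {poly K}}}) = 0.
Proof.
rewrite dx.unlock map_polyC0 ?map_deriv0 // map_polyX0 ?polyC0 ?deriv0 //.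
by rewrite -polyC1 derivC.
Qed.
Lemma dxZ : dx ('X : {poly {poly {poly K}}}) = 0.
Proof. rewrite dx.unlock; apply: map_polyX0; [exact: map_deriv0|exact: map_deriv1]. Qed.

Lemma dyCC (c : {poly K}) : dy c%:P%:P = 0.
Proof. by rewrite dyC derivC polyC0. Qed.
Lemma dxCC (c : K) : dx c%:P%:P%:P = 0.
Proof. by rewrite dxC derivC !polyC0. Qed.

End PartialsE.

Lemma lin_val (R T : comNzRingType) (e : {rmorphism R -> T}) (a b c : R) (k l m s t u : T) :
  e a = k -> e b = l -> e c = m ->
  e a * s + e b * t + e c * u = k * s + l * t + m * u.
Proof. by move=> -> -> ->. Qed.

Lemma rmorph_eq0 (R T : comNzRingType) (e : {rmorphism R -> T}) (a : R) : a = 0 -> e a = 0.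
Proof. by move=> ->; exact: rmorph0. Qed.
Lemma rmorph_eq1 (R T : comNzRingType) (e : {rmorphism R -> T}) (a : R) : a = 1 -> e a = 1.
Proof. by move=> ->; exact: rmorph1. Qed.

(** Both sides are derivations along [e] that agree on constants and on the three variables. *)
Lemma chain3 (K T : comNzRingType) (e : {rmorphism {poly {poly {poly K}}} -> T})
    (d : T -> T) :
  is_der id d -> (forall c : K, d (e c%:P%:P%:P) = 0) ->
  forall h, d (e h) = e (dx h) * d (e 'X%:P%:P) + e (dy h) * d (e 'X%:P)
                    + e (dz h) * d (e 'X).
Proof.
move=> hd de h.
have [dD dM] := hd.
have [xD xM] := ders_dx K; have [yD yM] := ders_dy K; have [zD zM] := ders_dz K.
have eD := rmorphD e; have eM := rmorphM e.
have e0 := @rmorph_eq0 _ _ e; have e1 := @rmorph_eq1 _ _ e.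
set tx := d (e 'X%:P%:P); set ty := d (e 'X%:P); set tz := d (e 'X).
apply: (@ders3_ext _ _ e (d \o e) (fun h => e (dx h) * tx + e (dy h) * ty + e (dz h) * tz)).
- by split=> a b; rewrite /comp ?eD ?eM ?dD ?dM.
- split=> a b.
    rewrite xD yD zD !eD !mulrDl [X in X + _ = _]addrACA; exact: addrACA.
  rewrite xM yM zM /comp !eD !eM.
  move: (e a) (e b) (e (dx a)) (e (dy a)) (e (dz a)) (e (dx b)) (e (dy b)) (e (dz b)).
  by move=> *; ring.
- move=> c; rewrite (lin_val _ _ _ (e0 _ (dxCC c)) (e0 _ (dyCC _)) (e0 _ (dzC _))).
  by rewrite !mul0r !addr0; exact: de.
- rewrite (lin_val _ _ _ (e1 _ (dxX K)) (e0 _ (dyCC _)) (e0 _ (dzC _))).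
  by rewrite !mul0r !addr0 mul1r.
- rewrite (lin_val _ _ _ (e0 _ (dxY K)) (e1 _ (dyY _)) (e0 _ (dzC _))).
  by rewrite !mul0r addr0 add0r mul1r.
- rewrite (lin_val _ _ _ (e0 _ (dxZ K)) (e0 _ (dyZ _)) (e1 _ (dzZ _))).
  by rewrite !mul0r !add0r mul1r.
Qed.

(** * Jacobian matrices in characteristic zero *)

Section CharZero.
Variable R : idomainType.
Hypothesis char0 : forall k : nat, k.+1%:R != 0 :> R.

Lemma char0_poly (k : nat) : k.+1%:R != 0 :> {poly R}.
Proof. by rewrite -polyC_natr polyC_eq0 char0. Qed.

Lemma char0_neq0 (k : nat) : (0 < k)%N -> k%:R != 0 :> R.
Proof. by case: k => // k _; exact: char0. Qed.

Lemma fact_neq0 (k : nat) : k`!%:R != 0 :> R.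
Proof. by rewrite char0_neq0 ?fact_gt0. Qed.

Lemma deriv_eq0 (p : {poly R}) : p^`() = 0 -> p = (p`_0)%:P.
Proof.
move=> p0; apply/polyP=> -[|i]; rewrite coefC //=.
have /eqP : p^`()`_i = 0 by rewrite p0 coef0.
by rewrite coef_deriv -mulr_natr mulf_eq0 (negbTE (char0 _)) orbF => /eqP.
Qed.

Lemma derivn_lead (p : {poly R}) : p != 0 ->
  exists2 c, c != 0 & p^`((size p).-1) = c%:P.
Proof.
move=> p0; exists (p^`((size p).-1))`_0.
  rewrite coef_derivn addn0 ffactnn -mulr_natr mulf_neq0 ?fact_neq0 //.
  by rewrite -lead_coefE lead_coef_eq0.
apply/polyP=> -[|i]; rewrite coefC //= coef_derivn nth_default ?mul0rn //.
by case: (size p) (size_poly_eq0 p) => [|n _]; rewrite ?(negbTE p0) //= addnS ltnS leq_addr.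
Qed.

End CharZero.

Definition partial (K : comNzRingType) (k : 'I_3) (p : {poly {poly {poly K}}}) :
  {poly {poly {poly K}}} :=
  match val k with 0 => dx p | 1 => dy p | _ => dz p end.

Definition var3 (K : comNzRingType) (k : 'I_3) : {poly {poly {poly K}}} :=
  match val k with 0 => 'X%:P%:P | 1 => 'X%:P | _ => 'X end.

Lemma ders_partial (K : comNzRingType) k : is_der id (@partial K k).
Proof.
case: k => [[|[|[|//]]] lt]; [exact: ders_dx|exact: ders_dy|exact: ders_dz].
Qed.

Lemma partial_cst (K : comNzRingType) k (c : K) : partial k c%:P%:P%:P = 0.
Proof.
case: k => [[|[|[|//]]] lt]; [exact: dxCC|exact: dyCC|exact: dzC].
Qed.

Lemma partial_var (K : comNzRingType) (i j : 'I_3) :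
  partial i (var3 K j) = (i == j)%:R.
Proof.
case: i j => [[|[|[|//]]] li] [[|[|[|//]]] lj].
- exact: dxX.
- exact: dxY.
- exact: dxZ.
- exact: dyCC.
- exact: dyY.
- exact: dyZ.
- exact: dzC.
- exact: dzC.
- exact: dzZ.
Qed.

Lemma chain_partial (K T : comNzRingType)
    (e : {rmorphism {poly {poly {poly K}}} -> T}) (d : T -> T) :
  is_der id d -> (forall c : K, d (e c%:P%:P%:P) = 0) ->
  forall h, d (e h) = \sum_(k < 3) e (partial k h) * d (e (var3 K k)).
Proof.
by move=> hd hc h; rewrite (chain3 hd hc) !big_ord_recr big_ord0 /= add0r.
Qed.

Section JacobianInjectivity.
Variable K : idomainType.
Hypothesis char0 : forall k : nat, k.+1%:R != 0 :> K.
Notation B := {poly {poly {poly K}}}.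

(* Iterated partial derivatives turn a nonzero polynomial into a nonzero constant. *)
Lemma partial_closed_eq0 (I : B -> Prop) :
  (forall h, I h -> I (dx h) /\ I (dy h) /\ I (dz h)) ->
  (forall c : K, I c%:P%:P%:P -> c = 0) -> forall h, I h -> h = 0.
Proof.
move=> Id Ic.
have c0x := char0_poly char0; have c0y := char0_poly c0x.
have step1 (c : {poly K}) : I c%:P%:P -> c = 0.
  move=> Icc; apply/eqP; apply/negPn/negP => cn0.
  have [a an0 ea] := derivn_lead char0 cn0.
  have /Ic a0 : I a%:P%:P%:P; last by rewrite a0 eqxx in an0.
  rewrite -ea; elim: (size c).-1 => [|n IH]; first by rewrite derivn0.
  by rewrite derivnS; have [+ _] := Id _ IH; rewrite dxC.
have step2 (c : {poly {poly K}}) : I c%:P -> c = 0.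
  move=> Icc; apply/eqP; apply/negPn/negP => cn0.
  have [a an0 ea] := derivn_lead c0x cn0.
  have /step1 a0 : I a%:P%:P; last by rewrite a0 eqxx in an0.
  rewrite -ea; elim: (size c).-1 => [|n IH]; first by rewrite derivn0.
  by rewrite derivnS; have [_ [+ _]] := Id _ IH; rewrite dyC.
move=> h Ih; apply/eqP; apply/negPn/negP => cn0.
have [a an0 ea] := derivn_lead c0y cn0.
have /step2 a0 : I a%:P; last by rewrite a0 eqxx in an0.
rewrite -ea; elim: (size h).-1 => [|n IH]; first by rewrite derivn0.
by rewrite derivnS; have [_ [_ +]] := Id _ IH; rewrite dz.unlock.
Qed.

(* The Jacobian matrix of a surjective endomorphism is invertible, so its
   kernel is stable under partial derivatives. *)
Lemma surj_endo_inj (e : {rmorphism B -> B}) :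
  (forall c : K, e c%:P%:P%:P = c%:P%:P%:P) -> (forall b, exists h, b = e h) ->
  forall h, e h = 0 -> h = 0.
Proof.
move=> ec es.
have [G hG] : exists G : 'I_3 -> B, forall k, var3 K k = e (G k).
  have [[g0 h0] [g1 h1]] := (es (var3 K 0), es (var3 K 1)).
  have [g2 h2] := es (var3 K 2%R).
  exists (fun k => match val k with 0 => g0 | 1 => g1 | _ => g2 end).
  by case=> [[|[|[|//]]] lt]; [exact: h0|exact: h1|exact: h2].
have chain i h : partial i (e h) = \sum_(k < 3) e (partial k h) * partial i (e (var3 K k)).
  apply: chain_partial; first exact: ders_partial.
  by move=> c; rewrite ec partial_cst.
pose M := \matrix_(j < 3, k < 3) e (partial k (G j)).
pose N := \matrix_(k < 3, i < 3) partial i (e (var3 K k)).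
(* This is the chain rule applied to [var3 K j = e (G j)]. *)
have MN : M *m N = 1%:M.
  apply/matrixP=> j i; rewrite !mxE eq_sym -partial_var hG chain.
  by apply: eq_bigr => k _; rewrite !mxE.
have NM := mulmx1C MN.
apply: (@partial_closed_eq0 (fun h => e h = 0)) => [h h0|c]; last first.
  by rewrite ec => /eqP; rewrite !polyC_eq0 => /eqP.
(* The gradient of [h] taken through [e]; then [r *m N] is the gradient of [e h], which is zero. *)
pose r := \row_(k < 3) e (partial k h).
have r0 : r = 0.
  rewrite -[r]mulmx1 -NM mulmxA; suff -> : r *m N = 0 by rewrite mul0mx.
  apply/rowP=> i; rewrite !mxE; transitivity (partial i (e h)).
    by rewrite chain; apply: eq_bigr => k _; rewrite !mxE.
  by rewrite h0; apply: ders0 (ders_partial _ _).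
have rk k : e (partial k h) = 0 by move/rowP/(_ k): r0; rewrite !mxE.
by split; [exact: (rk 0)|split; [exact: (rk 1)|exact: (rk 2)]].
Qed.

Lemma dydz_eq0 (h : B) : dy h = 0 -> dz h = 0 -> exists k, h = k%:P%:P.
Proof.
have c0x := char0_poly char0; have c0y := char0_poly c0x.
rewrite dz.unlock => hy /(deriv_eq0 c0y) eh.
move: hy; rewrite eh dyC => /polyC_inj/(deriv_eq0 c0x) ->.
by exists (h`_0)`_0.
Qed.

End JacobianInjectivity.

(** * Polynomially parametrised plane curves *)

Lemma nat_least (P : nat -> Prop) n : P n ->
  exists2 m, P m & forall k, P k -> (m <= k)%N.
Proof.
elim/ltn_ind: n => n IH Pn.
have [[k [Pk lt_kn]]|no] := classic (exists k, P k /\ (k < n)%N); first exact: IH Pk.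
by exists n => // k Pk; rewrite leqNgt; apply/negP => lt; apply: no; exists k.
Qed.

Section BivariateKernel.
Variable F : fieldType.

(** A nonconstant divisor of least degree is irreducible. *)
Lemma irreducible_divisor (c : {poly F}) : (1 < size c)%N ->
  exists2 p, irreducible_poly p & p %| c.
Proof.
move=> cgt1; pose P n := exists d, [/\ d %| c, (1 < size d)%N & size d = n].
have [n [d [dc dgt1 sd]] least] : exists2 n, P n & forall k, P k -> (n <= k)%N.
  by apply: (@nat_least P (size c)); exists c; rewrite dvdpp.
exists d => //; split=> // q q1 qd.
have c0 : c != 0 by rewrite -size_poly_gt0 ltnW.
have q0 : q != 0 by apply/eqP => q0; move: qd dgt1; rewrite q0 dvd0p => /eqP->; rewrite size_poly0.
have dn : d != 0 by rewrite -size_poly_gt0 ltnW.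
rewrite -dvdp_size_eqp // eqn_leq dvdp_leq //= sd.
apply: least; exists q; split=> //; first exact: dvdp_trans dc.
by rewrite ltn_neqAle eq_sym q1 size_poly_gt0.
Qed.

Lemma irreducible_prime (p a b : {poly F}) : irreducible_poly p ->
  p %| a * b -> p %| a \/ p %| b.
Proof.
move=> irr pab; have [pa|npa] := boolP (p %| a); [by left|right].
suff cop : coprimep p a by rewrite -(Gauss_dvdpr b cop).
rewrite /coprimep; apply/negPn/negP => sg.
by move: npa; rewrite -(eqp_dvdl _ (irr _ sg (dvdp_gcdl p a))) dvdp_gcdr.
Qed.

(* Gauss's lemma. *)
Lemma gauss_prime (p : {poly F}) (q t : {poly {poly F}}) : irreducible_poly p ->
  (exists r : {poly {poly F}}, q * t = p *: r) ->
  (exists q1 : {poly {poly F}}, q = p *: q1) \/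
  (exists t1 : {poly {poly F}}, t = p *: t1).
Proof.
move=> irr; have [n] := ubnP (size q + size t)%N.
elim: n q t => // n IH q t; rewrite ltnS => sqt [r qtr].
have [->|q0] := eqVneq q 0; first by left; exists 0; rewrite scaler0.
have [->|t0] := eqVneq t 0; first by right; exists 0; rewrite scaler0.
(* Removing a leading term divisible by [p] changes [s] by a multiple of [p] and lowers its size.
   Since [p] divides the product of the leading coefficients, this applies to [q] or to [t]. *)
have lead_dec (s : {poly {poly F}}) : s != 0 -> p %| lead_coef s ->
    exists (s0 l : {poly {poly F}}), s = s0 + p *: l /\ (size s0 < size s)%N.
  move=> s0 /dvdpP[c lc].
  exists (s - lead_coef s *: 'X^((size s).-1)), (c *: 'X^((size s).-1)); split.
    by rewrite scalerA mulrC -lc subrK.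
  have szs : (0 < size s)%N by rewrite size_poly_gt0.
  rewrite -[X in (_ < X)%N](prednK szs) ltnS; apply/leq_sizeP => j lej.
  rewrite coefB coefZ coefXn; have [->|nej] := eqVneq j (size s).-1.
    by rewrite mulr1 subrr.
  rewrite mulr0 subr0 nth_default // -(prednK szs) ltn_neqAle eq_sym nej.
  exact: lej.
have /(irreducible_prime irr) : p %| lead_coef q * lead_coef t.
  rewrite -lead_coefM qtr lead_coefZ; exact: dvdp_mulr.
case=> [/(lead_dec _ q0)|/(lead_dec _ t0)] [s0 [l [es lts]]].
  have [|||] := IH s0 t.
  - by apply: leq_trans sqt; rewrite ltn_add2r.
  - exists (r - l * t); rewrite scalerBr -qtr es mulrDl -scalerAl addrK //.
  - by case=> q1 e1; left; exists (q1 + l); rewrite scalerDr -e1.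
  - by right.
have [|||] := IH q s0.
- by apply: leq_trans sqt; rewrite ltn_add2l.
- exists (r - q * l); rewrite scalerBr -qtr es mulrDr -scalerAr addrK //.
- by left.
- by case=> t1 e1; right; exists (t1 + l); rewrite scalerDr -e1.
Qed.

(* The generator has least w-degree and then a leading coefficient of least
   degree; by Gauss's lemma pseudo-division by it is exact. *)
Lemma ev1_kernel_principal (S : idomainType) (g : {rmorphism {poly F} -> S}) (b : S) :
  (forall c, g c = 0 -> c = 0) ->
  exists q : {poly {poly F}}, forall i : {poly {poly F}},
    ev1 g b i = 0 <-> exists t : {poly {poly F}}, i = t * q.
Proof.
move=> ginj; set e := ev1 g b.
have [[q0 [q0n eq0]]|none] := classic (exists q : {poly {poly F}}, q != 0 /\ e q = 0); last first.
  exists 0 => i; split=> [ei|[t ->]]; last by rewrite mulr0 rmorph0.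
  exists 0; rewrite mulr0; apply/eqP; apply/negPn/negP => i0.
  by apply: none; exists i.
pose P n := exists q : {poly {poly F}}, [/\ q != 0, e q = 0 & size q = n].
have [n [q1 [q1n eq1 sq1]] leastn] : exists2 n, P n & forall k, P k -> (n <= k)%N.
  by apply: (@nat_least P (size q0)); exists q0.
pose Q m := exists q : {poly {poly F}}, [/\ q != 0, e q = 0, size q = n & size (lead_coef q) = m].
have [m [q [qn eq sq sl]] leastm] : exists2 m, Q m & forall k, Q k -> (m <= k)%N.
  by apply: (@nat_least Q (size (lead_coef q1))); exists q1.
have eZ (c : {poly F}) (i : {poly {poly F}}) : e (c *: i) = g c * e i.
  by rewrite -mul_polyC rmorphM /e ev1C.
exists q => i; split=> [ei|[t ->]]; last by rewrite rmorphM eq mulr0.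
(* The pseudo-remainder lies in the kernel and has smaller w-degree than [q], hence is zero. *)
have [c [t0 [cn ci]]] : exists (c : {poly F}) (t : {poly {poly F}}), c != 0 /\ c *: i = t * q.
  exists (lead_coef q ^+ scalp i q), (i %/ q); split.
    by rewrite expf_neq0 // lead_coef_eq0.
  rewrite Pdiv.Idomain.divp_eq; suff -> : i %% q = 0 by rewrite addr0.
  apply/eqP/negPn/negP => rn.
  have er : e (i %% q) = 0.
    have := eZ (lead_coef q ^+ scalp i q) i.
    by rewrite ei mulr0 Pdiv.Idomain.divp_eq rmorphD rmorphM eq mulr0 add0r.
  have : (size (i %% q)%R < size q)%N by rewrite ltn_modp.
  by rewrite sq ltnNge leastn //; exists (i %% q).
(* Strip the irreducible factors of [c] one at a time. Such a factor divides [t0]: dividing [q] by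
   it would give a kernel element of the same w-degree with a smaller leading coefficient. *)
have [k] := ubnP (size c); elim: k c cn t0 ci => // k IH c cn t0 ci.
rewrite ltnS => sc; have [c1|cgt1] := leqP (size c) 1.
  have := cn; rewrite (size1_polyC c1) polyC_eq0 => c00.
  exists ((c`_0)^-1%:P *: t0); rewrite -scalerAl -ci (size1_polyC c1) coefC /=.
  by rewrite scalerA -polyCM mulVf // scale1r.
have [p irr /dvdpP[c' ec]] := irreducible_divisor cgt1.
have pn := irredp_neq0 irr.
have c'n : c' != 0 by apply: contraNneq cn => c'0; rewrite ec c'0 mul0r.
have pinj (x y : {poly {poly F}}) : p *: x = p *: y -> x = y.
  move=> /eqP; rewrite -subr_eq0 -scalerBr -mul_polyC mulf_eq0 polyC_eq0 (negbTE pn).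
  by rewrite subr_eq0 => /eqP.
have lt_size (d : {poly F}) : d != 0 -> (size d < size (p * d)%R)%N.
  move=> dn; rewrite size_mul //; case: (size p) irr.1 => [|[|s]] // _.
  by rewrite addSn /= addSn ltnS leq_addl.
have [|[u qu]|[u tu]] := @gauss_prime p t0 q irr.
- by exists (c' *: i); rewrite scalerA [p * _]mulrC -ec ci.
- apply: (IH c' c'n u); last by apply: leq_trans sc; rewrite ec mulrC lt_size.
  by apply: pinj; rewrite scalerA [p * _]mulrC -ec ci qu scalerAl.
have un : u != 0 by apply: contraNneq qn => u0; rewrite tu u0 scaler0.
have : (size (lead_coef u) < size (lead_coef q))%N.
  by rewrite tu lead_coefZ lt_size // lead_coef_eq0.
rewrite sl ltnNge leastm //; exists u; split=> //.
  have /eqP : e q = 0 by []. 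
  rewrite tu eZ mulf_eq0 => /orP[/eqP/ginj p0|/eqP //].
  by rewrite p0 eqxx in pn.
by rewrite -sq tu -mul_polyC size_Cmul.
Qed.

(** Coefficients are treated one by one. With [g] the evaluation at l, [d] is x - l; nesting gives
    the case of several variables. *)
Lemma map_poly_eq0_dvd (R S : comNzRingType) (g : {rmorphism R -> S}) (d : R) :
  (forall c, g c = 0 -> exists c', c = d * c') ->
  forall p, map_poly g p = 0 -> exists p', p = d%:P * p'.
Proof.
move=> hd; elim/poly_ind => [|p c IH] gp; first by exists 0; rewrite mulr0.
have gc : g c = 0.
  by move/polyP/(_ 0%N): gp; rewrite coef_map coefD coefMX coefC add0r coef0.
have /IH[p' ->] : map_poly g p = 0.
  apply/polyP=> i; move/polyP/(_ i.+1): gp.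
  by rewrite !coef_map coefD coefMX coefC addr0 !coef0.
have [c' ->] := hd _ gc.
by exists (p' * 'X + c'%:P); rewrite mulrDr mulrA polyCM.
Qed.

Lemma horner_eq0_dvd (l : F) (c : {poly F}) : horner_eval l c = 0 ->
  exists c', c = ('X - l%:P) * c'.
Proof.
by move=> /rootP/factor_theorem[q ->]; exists q; rewrite mulrC.
Qed.

(** Restriction to the plane curve t -> (a(t), b(t)): the inner variable goes to [a], the outer one
    to [b]. *)
Definition ev2 (a b : {poly F}) : {rmorphism {poly {poly F}} -> {poly F}} :=
  ev1 (ev1 polyC a) b.

Lemma ev1_polyC (a c : {poly F}) : ev1 polyC a c = c \Po a.
Proof. by []. Qed.

(** If [a] is nonconstant, composition with [a] is injective and the previous kernel lemma applies.
    Otherwise [b] is nonconstant and the curve is the line where the inner variable equals the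
    constant [a]. *)
Lemma ev2_kernel_principal (a b : {poly F}) : (1 < size a)%N \/ (1 < size b)%N ->
  exists q : {poly {poly F}}, forall i : {poly {poly F}},
    ev2 a b i = 0 <-> exists t : {poly {poly F}}, i = t * q.
Proof.
have [a1 _|a1 [//|b1]] := ltnP 1 (size a).
  apply: ev1_kernel_principal => c; rewrite ev1_polyC => /eqP.
  by rewrite comp_poly_eq0 // => /eqP.
exists ('X - (a`_0)%:P)%:P => i; split=> [ei|[t ->]]; last first.
  rewrite rmorphM /= /ev2 ev1C ev1_polyC (size1_polyC a1) coefC /=.
  by rewrite comp_polyB comp_polyX comp_polyC subrr mulr0.
have [|p' ->] := @map_poly_eq0_dvd _ _ (horner_eval a`_0) _ (@horner_eq0_dvd _) i.
  have : map_poly (horner_eval a`_0) i \Po b == 0.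
    rewrite -ei /ev2 ev1E /comp_poly -map_poly_comp; apply/eqP.
    congr (_.[b]); apply: eq_map_poly => c /=.
    by rewrite ev1_polyC (size1_polyC a1) comp_polyCr coefC.
  by rewrite comp_poly_eq0 // => /eqP.
by exists p'; rewrite mulrC.
Qed.

End BivariateKernel.

(** * Locally nilpotent derivations *)

Section IterDerivation.
Variables (B : comNzRingType) (D : B -> B).
Hypothesis hD : is_der id D.

Lemma iter_dersD n a b : iter n D (a + b) = iter n D a + iter n D b.
Proof. by case: hD => DD _; elim: n => //= n ->; rewrite DD. Qed.

Lemma iter_ders0 n : iter n D 0 = 0.
Proof. by elim: n => //= n ->; exact: ders0 hD. Qed.

Lemma ders_linear (s : B) : D s = 0 -> forall r, D (s * r) = s * D r.
Proof. by case: hD => _ DM s0 r; rewrite DM s0 mulr0 addr0. Qed.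

Lemma iter_ders_linear n (s : B) : D s = 0 -> forall r, iter n D (s * r) = s * iter n D r.
Proof. by move=> s0 r; elim: n => //= n ->; rewrite ders_linear. Qed.

Section Quotient.
Variables (C : comNzRingType) (q : {rmorphism B -> C}).
Hypothesis stable : forall b, q b = 0 -> q (D b) = 0.

Lemma iter_stable n b : q b = 0 -> q (iter n D b) = 0.
Proof. by move=> qb; elim: n => //= n /stable. Qed.

(** All terms of the Leibniz formula but one contain a factor killed by [q]; the induction is
    Pascal's rule. *)
Lemma iter_ders_prod n m r s :
  q (iter n.+1 D r) = 0 -> q (iter m.+1 D s) = 0 ->
  q (iter (n + m) D (r * s)) = 'C(n + m, n)%:R * q (iter n D r) * q (iter m D s).
Proof.
have [_ DM] := hD.
have [k] := ubnP (n + m); elim: k n m r s => // k IH [|n] [|m] r s; rewrite ltnS => nm hr hs.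
- by rewrite bin0 mul1r -rmorphM.
- have E := IH 0%N m r (D s) nm hr; rewrite -!iterSr !add0n !bin0 !mul1r in E *.
  rewrite iterSr DM iter_dersD rmorphD E //.
  by rewrite (iter_stable _ (b := s * D r)) ?addr0 // rmorphM hr mulr0.
- have E := IH n 0%N (D r) s; rewrite -!iterSr !addn0 !binn !mul1r in E nm *.
  rewrite iterSr DM iter_dersD rmorphD [s * D r]mulrC E //.
  by rewrite (iter_stable _ (b := r * D s)) ?add0r // rmorphM hs mulr0.
- have E1 := IH n.+1 m r (D s); have E2 := IH n m.+1 (D r) s.
  rewrite -!iterSr !addSn !addnS in E1 E2 nm *.
  rewrite iterSr DM iter_dersD rmorphD [s * D r]mulrC E1 // E2 //.
  by rewrite [in RHS]binS natrD !mulrDl.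
Qed.

End Quotient.

Definition nilp (b : B) : Prop := exists m, iter m D b = 0.

Lemma nilpD a b : nilp a -> nilp b -> nilp (a + b).
Proof.
move=> [n hn] [m hm]; exists (n + m)%N; rewrite iter_dersD.
by rewrite [X in _ + X]iterD hm iter_ders0 addr0 addnC iterD hn iter_ders0.
Qed.

(** By the preceding formula with [q] the identity, D^(n+m)(ab) is an integer multiple of D^n(a)
    D^m(b), and one more [D] kills it. *)
Lemma nilpM a b : nilp a -> nilp b -> nilp (a * b).
Proof.
have nz c : nilp c -> exists m, iter m.+1 D c = 0.
  by move=> [m hm]; exists m; rewrite iterS hm; exact: ders0 hD.
move=> /nz[n hn] /nz[m hm]; exists (n + m).+1.
have [DD DM] := hD.
have stable c : (idfun : {rmorphism B -> B}) c = 0 -> (idfun : {rmorphism B -> B}) (D c) = 0.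
  by move=> /= ->; exact: ders0 hD.
have := iter_ders_prod stable hn hm; rewrite iterS /= => ->.
rewrite DM -iterS hm mulr0 add0r DM -iterS hn mulr0 add0r.
suff -> : D 'C(n + m, n)%:R = 0 by rewrite !mulr0.
elim: ('C(n + m, n)) => [|k IH]; first exact: ders0 hD.
rewrite -natr1 DD IH add0r; have := DM 1 1; rewrite !mul1r => /eqP.
by rewrite -subr_eq0 opprD addNKr oppr_eq0 => /eqP.
Qed.

(** Modulo the kernel of [q], [D] is a locally nilpotent derivation of a domain, where the
    nilpotency degree is additive on products. A nonzero product killed by it has degree 0, and so
    have its factors. *)
Lemma factorially_closed (C : idomainType) (q : {rmorphism B -> C}) :
  (forall k : nat, k.+1%:R != 0 :> C) ->
  (forall b, nilp b) -> (forall b, q b = 0 -> q (D b) = 0) ->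
  forall r s, q (D (r * s)) = 0 -> q (r * s) != 0 -> q (D r) = 0.
Proof.
move=> c0 nil stable r s drs; rewrite rmorphM mulf_eq0 negb_or => /andP[rn sn].
have top t : q t != 0 -> exists n, q (iter n D t) != 0 /\ q (iter n.+1 D t) = 0.
  move=> tn; have [m hm] := nil t.
  have [n hn least] : exists2 n, q (iter n D t) = 0 & forall k, q (iter k D t) = 0 -> (n <= k)%N.
    by apply: (@nat_least (fun n => q (iter n D t) = 0) m); rewrite hm rmorph0.
  case: n hn least => [/= h0|n hn least]; first by rewrite h0 eqxx in tn.
  by exists n; split=> //; apply/eqP => /least; rewrite ltnn.
have [n [n1 n2]] := top r rn; have [m [m1 m2]] := top s sn.
case: n n1 n2 => [|n] n1 n2; first by [].
have : q (iter (n.+1 + m) D (r * s)) != 0.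
  rewrite (iter_ders_prod stable n2 m2) !mulf_neq0 //.
  by apply: (char0_neq0 c0); rewrite bin_gt0 leq_addr.
by rewrite addSn iterSr (iter_stable stable) ?eqxx.
Qed.

End IterDerivation.

(** Expand [p] at [t] and evaluate at 0 = t - t. *)
Lemma taylor_const (C : idomainType) (p : {poly C}) (t : C) :
  (forall k : nat, k.+1%:R != 0 :> C) ->
  (forall i, p^`(i.+1).[t] = 0) -> p.[t] = p`_0.
Proof.
move=> c0 hp; rewrite -(horner_coef0 p) -(subrr t).
rewrite (@nderiv_taylor_wide _ (size p).+1) //; last exact: mulrC.
rewrite big_ord_recl /= nderivn0 expr0 mulr1 big1 ?addr0 // => i _.
have /eqP := hp i; rewrite nderivn_def hornerMn -mulr_natr mulf_eq0.
by rewrite (negbTE (fact_neq0 c0 _)) orbF => /eqP->; rewrite mul0r.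
Qed.

(** * Triangular derivations of K[x, y, z] *)

Section TriangularKernel.
Variable K : comNzRingType.
Notation B := {poly {poly {poly K}}}.
Variables (a : {poly K}) (b : {poly {poly K}}).

Definition kx : {rmorphism {poly K} -> B} := polyCC {poly K}.

(* In [{poly {poly {poly K}}}] the coordinates x, y, z are ['X%:P%:P],
   ['X%:P], ['X]; [linP] is P = a(x) z + b(x, y), [evP] substitutes it for
   the outer variable of [{poly {poly K}}] and [evPy] substitutes (x, P, y). *)
Definition linP : B := a%:P%:P * 'X + b%:P.

Definition evP : {rmorphism {poly {poly K}} -> B} := ev1 kx linP.

Definition evPy : {rmorphism {poly {poly {poly K}}} -> B} := ev1 evP 'X%:P.

End TriangularKernel.

(* The derivation a d/dy - b_y d/dz, which kills x and P. *)
HB.lock Definition Dab (K : comNzRingType) (a : {poly K}) (b : {poly {poly K}})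
    (r : {poly {poly {poly K}}}) : {poly {poly {poly K}}} :=
  a%:P%:P * dy r - (b^`())%:P * dz r.

Section TriangularKernelTheory.
Variable K : comNzRingType.
Notation B := {poly {poly {poly K}}}.
Variables (a : {poly K}) (b : {poly {poly K}}).
Notation D := (Dab a b).
Notation P := (linP a b).

Lemma DabE r : D r = a%:P%:P * dy r - (b^`())%:P * dz r.
Proof. by rewrite Dab.unlock. Qed.

Lemma ders_lin (R : comNzRingType) (s t : R) (d1 d2 : R -> R) :
  is_der id d1 -> is_der id d2 -> is_der id (fun r => s * d1 r - t * d2 r).
Proof.
move=> [h1 g1] [h2 g2]; split=> u v; rewrite ?h1 ?h2 ?g1 ?g2; ring.
Qed.

Lemma ders_Dab : is_der id D.
Proof. exact: ders_eq DabE (ders_lin _ _ (ders_dy K) (ders_dz K)). Qed.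

Lemma lin_val2 (R : comNzRingType) (s t u v u' v' : R) :
  u = u' -> v = v' -> s * u - t * v = s * u' - t * v'.
Proof. by move=> -> ->. Qed.

Lemma Dab_x (c : {poly K}) : D c%:P%:P = 0.
Proof. by rewrite DabE (lin_val2 _ _ (dyCC c) (dzC _)) !mulr0 subr0. Qed.

Lemma polyCCM (c d : {poly K}) : (c * d)%:P%:P = c%:P%:P * d%:P%:P :> B.
Proof. by rewrite !polyCM. Qed.

Lemma Dab_y : D 'X%:P = a%:P%:P.
Proof. by rewrite DabE (lin_val2 _ _ (dyY K) (dzC _)) mulr1 mulr0 subr0. Qed.

Lemma Dab_z : D 'X = - (b^`())%:P.
Proof. by rewrite DabE (lin_val2 _ _ (dyZ K) (dzZ K)) mulr0 mulr1 add0r. Qed.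

Lemma Dab_C (c : {poly {poly K}}) : D c%:P = (a%:P * c^`())%:P.
Proof. by rewrite DabE (lin_val2 _ _ (dyC c) (dzC c)) mulr0 subr0 polyCM. Qed.

Lemma Dab_P : D P = 0.
Proof.
case: ders_Dab => DD _; rewrite /linP DD (ders_linear ders_Dab (Dab_x a)) Dab_z Dab_C.
by rewrite mulrN -polyCM addNr.
Qed.

Lemma evP_C (c : {poly K}) : evP a b c%:P = c%:P%:P.
Proof. exact: ev1C. Qed.
Lemma evP_X : evP a b 'X = P.
Proof. exact: ev1X. Qed.
Lemma evPy_P r : evPy a b r%:P = evP a b r.
Proof. exact: ev1C. Qed.
Lemma evPy_y : evPy a b 'X = 'X%:P.
Proof. exact: ev1X. Qed.

Lemma Dab_evP r : D (evP a b r) = 0.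
Proof.
have hd : is_der (evP a b) (D \o evP a b).
  by case: ders_Dab => DD DM; split=> u v; rewrite /comp ?rmorphD ?rmorphM ?DD ?DM.
apply: (ders_ext hd (d' := fun=> 0)).
- by split=> *; rewrite ?addr0 // !mulr0 addr0.
- by move=> c; rewrite /comp evP_C Dab_x.
- by rewrite /comp evP_X Dab_P.
Qed.

(** In terms of x, P, y the derivation is a d/dy, as it kills x and P and sends y to [a]. *)
Lemma Dab_evPy h : D (evPy a b h) = a%:P%:P * evPy a b h^`().
Proof.
set e := evPy a b.
have hd : is_der e (D \o e).
  by case: ders_Dab => DD DM; split=> u v; rewrite /comp ?rmorphD ?rmorphM ?DD ?DM.
apply: (ders_ext hd (d' := fun h => a%:P%:P * e h^`())).
- split=> u v; first by rewrite derivD rmorphD mulrDr.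
  rewrite derivM rmorphD !rmorphM.
  move: (e u) (e v) (e u^`()) (e v^`()) (a%:P%:P) => *; ring.
- by move=> c; rewrite /comp /e evPy_P Dab_evP derivC rmorph0 mulr0.
- by rewrite /comp /e evPy_y Dab_y derivX rmorph1 mulr1.
Qed.

Lemma iter_Dab_evPy n h : iter n D (evPy a b h) = (a ^+ n)%:P%:P * evPy a b h^`(n).
Proof.
elim: n => [|n IH]; first by rewrite expr0 !polyC1 mul1r derivn0.
rewrite iterS IH (ders_linear ders_Dab (Dab_x _)) Dab_evPy -derivnS mulrA.
have E : (a ^+ n.+1)%:P%:P = (a ^+ n)%:P%:P * a%:P%:P :> B.
  by rewrite exprSr; exact: polyCCM.
exact: (congr1 (fun x => x * evPy a b h^`(n.+1)) (esym E)).
Qed.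

Lemma nilp_Dab r : nilp D r.
Proof.
have nC (c : {poly {poly K}}) : nilp D c%:P.
  have iC n : iter n D c%:P = ((a ^+ n)%:P * c^`(n))%:P.
    elim: n => [|n IH]; first by rewrite expr0 polyC1 mul1r derivn0.
    by rewrite iterS IH Dab_C derivM derivC mul0r add0r mulrA -polyCM -exprS derivnS.
  by exists (size c); rewrite iC derivn_poly0 // mulr0 polyC0.
have nX : nilp D 'X.
  have [m hm] := nC (- b^`()); exists m.+1.
  by rewrite iterSr Dab_z -polyCN.
elim/poly_ind: r => [|p c IH]; first by exists 0%N.
by apply: (nilpD ders_Dab) => //; apply: (nilpM ders_Dab).
Qed.

Lemma evPy_x (c : {poly K}) : evPy a b c%:P%:P = c%:P%:P.
Proof. by rewrite evPy_P evP_C. Qed.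

Lemma evPy_C (c : {poly {poly K}}) : evPy a b (map_poly polyC c) = c%:P.
Proof.
have := @rmorph_ext _ _ (evPy a b \o map_poly polyC) (polyC : {rmorphism _ -> _}).
apply=> [d|] /=; first by rewrite map_polyC evPy_x.
by rewrite map_polyX evPy_y.
Qed.

(** Since a z = P - b(x, y), inverting [a] puts z into K[x, P, y]. *)
Lemma clear_denominators r : exists n h, (a ^+ n)%:P%:P * r = evPy a b h.
Proof.
have absM (R S : comNzRingType) (e : {rmorphism S -> R}) (s t r1 r2 : R) (s' t' h1 h2 : S) :
    e s' = s -> e t' = t -> s * r1 = e h1 -> t * r2 = e h2 ->
    s * t * (r1 * r2) = e (h1 * h2) /\ s * t * (r1 + r2) = e (t' * h1 + s' * h2).
  move=> es et e1 e2; rewrite rmorphD !rmorphM -e1 -e2 es et; split; ring.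
have pD n m : (a ^+ (n + m))%:P%:P = (a ^+ n)%:P%:P * (a ^+ m)%:P%:P :> B.
  by rewrite exprD polyCCM.
elim/poly_ind: r => [|p c [n [h eh]]].
  by exists 0%N, 0; rewrite mulr0 rmorph0.
have [h1 e1] : exists h1, (a ^+ 1)%:P%:P * 'X = evPy a b h1.
  exists ('X%:P - map_poly polyC b); rewrite rmorphB evPy_C evPy_P evP_X.
  by rewrite expr1 addrK.
have [e2 _] := absM _ _ _ _ _ _ _ _ _ _ _ (evPy_x (a ^+ n)) (evPy_x (a ^+ 1)) eh e1.
have e3 : (a ^+ 0)%:P%:P * c%:P = evPy a b (map_poly polyC c).
  by rewrite expr0 !polyC1 mul1r evPy_C.
rewrite -pD in e2.
have [_ e4] := absM _ _ _ _ _ _ _ _ _ _ _ (evPy_x (a ^+ (n + 1))) (evPy_x (a ^+ 0)) e2 e3.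
exists (n + 1 + 0)%N; eexists; rewrite pD; exact: e4.
Qed.

End TriangularKernelTheory.

(** * Quotient by a coordinate *)

Lemma ev1_im (R S T : comNzRingType) (f : {rmorphism R -> T}) (g : {rmorphism S -> T}) t :
  (forall c, exists s, f c = g s) -> (exists s, t = g s) ->
  forall p, exists s, ev1 f t p = g s.
Proof.
move=> hf [t' ->]; elim/poly_ind => [|p c [s hs]].
  by exists 0; rewrite !rmorph0.
have [c' hc] := hf c; exists (s * t' + c').
by rewrite rmorphD rmorphM ev1X ev1C hs hc rmorphD rmorphM.
Qed.

Lemma mul_eq_polyC (R : idomainType) (p q : {poly R}) (c : R) :
  c != 0 -> p * q = c%:P -> exists k l, [/\ p = k%:P, q = l%:P & k * l = c].
Proof.
move=> c0 pq.
have pq0 : p * q != 0 by rewrite pq polyC_eq0.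
have [p0 q0] : p != 0 /\ q != 0 by move: pq0; rewrite mulf_eq0 negb_or => /andP.
have [] : (size p <= 1)%N /\ (size q <= 1)%N.
  have := size_mul p0 q0; rewrite pq size_polyC c0 /=.
  move: p0 q0; rewrite -!size_poly_gt0; case: (size p) (size q) => [|n] [|m] // _ _.
  by rewrite addSn addnS /= => -[] /esym/eqP; rewrite addn_eq0 => /andP[/eqP-> /eqP->].
move=> /size1_polyC ep /size1_polyC eq; exists p`_0, q`_0; split=> //.
by apply: polyC_inj; rewrite polyCM -ep -eq.
Qed.

Section CoordinateQuotient.
Variable F : fieldType.
Hypothesis char0 : forall k : nat, k.+1%:R != 0 :> F.
Notation B := {poly {poly {poly F}}}.

(** Reduction modulo x - l, leaving y as the inner and z as the outer variable. *)
Definition at_inner (l : F) : {rmorphism B -> {poly {poly F}}} :=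
  map_poly (map_poly (horner_eval l)).

Lemma at_inner_eq0 (l : F) (r : B) : at_inner l r = 0 ->
  exists s, r = ('X - l%:P)%:P%:P * s.
Proof.
apply: map_poly_eq0_dvd => c; apply: map_poly_eq0_dvd => d; exact: horner_eq0_dvd.
Qed.

Lemma at_innerC l (c : {poly F}) : at_inner l c%:P%:P = (c.[l])%:P%:P.
Proof. by rewrite /at_inner /= map_polyC /= map_polyC. Qed.
Lemma at_innerY l : at_inner l 'X%:P = 'X%:P.
Proof. by rewrite /at_inner /= map_polyC /= map_polyX. Qed.
Lemma at_innerZ l : at_inner l 'X = 'X.
Proof. by rewrite /at_inner /= map_polyX. Qed.
Lemma at_inner_C l (c : {poly {poly F}}) : at_inner l c%:P = (map_poly (horner_eval l) c)%:P.
Proof. by rewrite /at_inner /= map_polyC. Qed.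

Lemma map_hornerK (l : F) (p : {poly F}) : map_poly (horner_eval l) (map_poly polyC p) = p.
Proof.
by rewrite -map_poly_comp map_poly_id // => c _ /=; rewrite /horner_eval hornerC.
Qed.

Variables (u v w : B) (m : F).
Hypothesis gen_uvw : forall r, exists h, r = ev3 (iC F) u v w h.

(** [q] sends u to m and v, w to two free variables. It exists because the surjective endomorphism
    [e] is injective, hence has an inverse [f]. By the last clause a morphism to F[t] that sends u
    to m factors through [q] as a parametrised curve. *)
Lemma coordinate_quotient : exists q : {rmorphism B -> {poly {poly F}}},
  [/\ forall c, exists r, q r = c,
      forall r, q r = 0 <-> exists s, r = (u - m%:P%:P%:P) * s
    & forall e : {rmorphism B -> {poly F}}, (forall c : F, e c%:P%:P%:P = c%:P) ->
      e u = m%:P -> forall r, e r = ev2 (e v) (e w) (q r)].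
Proof.
set e := ev3 (iC F) u v w.
have eC (c : F) : e c%:P%:P%:P = c%:P%:P%:P by exact: ev3C.
have [eX [eY eZ]] : e 'X%:P%:P = u /\ e 'X%:P = v /\ e 'X = w.
  by split; [exact: ev3X|split; [exact: ev3Y|exact: ev3Z]].
have einj := surj_endo_inj char0 eC gen_uvw.
have [g0 h0] := gen_uvw 'X%:P%:P; have [g1 h1] := gen_uvw 'X%:P; have [g2 h2] := gen_uvw 'X.
pose f := ev3 (iC F) g0 g1 g2.
have fC (c : F) : f c%:P%:P%:P = c%:P%:P%:P by exact: ev3C.
have [fX [fY fZ]] : f 'X%:P%:P = g0 /\ f 'X%:P = g1 /\ f 'X = g2.
  by split; [exact: ev3X|split; [exact: ev3Y|exact: ev3Z]].
have efC (c : F) : e (f c%:P%:P%:P) = c%:P%:P%:P by rewrite fC eC.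
have efX : e (f 'X%:P%:P) = 'X%:P%:P by rewrite fX -h0.
have efY : e (f 'X%:P) = 'X%:P by rewrite fY -h1.
have efZ : e (f 'X) = 'X by rewrite fZ -h2.
have ef r : e (f r) = r.
  exact: (@ev3_ext _ _ (e \o f) idfun efC efX efY efZ).
have fe h : f (e h) = h.
  by apply/eqP; rewrite -subr_eq0; apply/eqP/einj; rewrite rmorphB ef subrr.
clearbody e f.
exists (at_inner m \o f); split=> [c|r|e' e'C e'u r].
- exists (e (map_poly (map_poly polyC) c)); rewrite -[LHS]/(at_inner m (f _)) fe.
  rewrite /at_inner -[LHS]/(map_poly _ (map_poly _ _)) -map_poly_comp map_poly_id //.
  by move=> d _; exact: map_hornerK.
- have fum : u - m%:P%:P%:P = e ('X - m%:P)%:P%:P by rewrite !polyCB rmorphB eX eC.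
  split=> [/at_inner_eq0[s es]|[s ->]].
    by exists (e s); rewrite fum -rmorphM -es ef.
  rewrite rmorphM fum -[X in X * _]/(at_inner m (f (e _))) fe at_innerC.
  by rewrite hornerXsubC subrr !polyC0 mul0r.
have e1 (c : F) : e' (e c%:P%:P%:P) = ev2 (e' v) (e' w) (at_inner m c%:P%:P%:P).
  by rewrite eC e'C at_innerC hornerC /ev2 !ev1C.
have e2 : e' (e 'X%:P%:P) = ev2 (e' v) (e' w) (at_inner m 'X%:P%:P).
  by rewrite eX e'u at_innerC hornerX /ev2 !ev1C.
have e3 : e' (e 'X%:P) = ev2 (e' v) (e' w) (at_inner m 'X%:P).
  by rewrite eY at_innerY /ev2 ev1C ev1X.
have e4 : e' (e 'X) = ev2 (e' v) (e' w) (at_inner m 'X).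
  by rewrite eZ at_innerZ /ev2 ev1X.
rewrite -[in LHS](ef r).
exact: (@ev3_ext _ _ (e' \o e) (ev2 (e' v) (e' w) \o at_inner m) e1 e2 e3 e4).
Qed.

End CoordinateQuotient.

(** Composition with [r] multiplies degrees by deg r > 0. The remainder of [h] by [g], composed with
    [r], is a multiple of g o r of smaller degree, hence zero. *)
Lemma dvd_comp (F : fieldType) (g h s : {poly F}) (r : {poly F}) : (1 < size r)%N ->
  h \Po r = (g \Po r) * s -> exists t, h = g * t.
Proof.
move=> r1 e; have [g0|gn] := eqVneq g 0.
  move: e; rewrite g0 comp_poly0 mul0r => /eqP; rewrite comp_poly_eq0 // => /eqP ->.
  by exists 0; rewrite mulr0.
exists (h %/ g); rewrite [LHS](divp_eq h g) mulrC; suff -> : h %% g = 0 by rewrite addr0.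
apply/eqP/negPn/negP => rn.
have : g \Po r %| (h %% g) \Po r.
  apply/dvdpP; exists (s - ((h %/ g) \Po r)).
  rewrite mulrBl [s * _]mulrC -e [in h \Po r](divp_eq h g) comp_polyD comp_polyM.
  by rewrite addrC addKr.
have cn p : p != 0 -> p \Po r != 0 by rewrite comp_poly_eq0.
move/(dvdp_leq (cn _ rn)).
have := ltn_modp h g; rewrite gn.
have := size_comp_poly g r; have := size_comp_poly (h %% g) r.
move: (cn _ gn) (cn _ rn) (gn) (rn) (r1); rewrite -!size_poly_gt0.
case: (size (g \Po r)) (size ((h %% g) \Po r)) (size g) (size (h %% g)) (size r) =>
  [|n1] [|n2] [|n3] [|n4] [|[|n5]] //= _ _ _ _ _ -> ->.
by rewrite !ltnS leq_pmul2r // => lt; rewrite leqNgt lt.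
Qed.

(** * Fibres of degree at least two *)

Lemma rmorph_mul0 (R S : comNzRingType) (q : {rmorphism R -> S}) (x y : R) :
  q x = 0 -> q (x * y) = 0.
Proof. by move=> qx; rewrite rmorphM qx mul0r. Qed.

Section BadFibre.
Variable F : fieldType.
Hypothesis char0 : forall k : nat, k.+1%:R != 0 :> F.
Notation B := {poly {poly {poly F}}}.
Variables (a : {poly F}) (b : {poly {poly F}}) (l : F).
Notation sg := (at_inner l).
Notation phi := (map_poly (horner_eval l) b).
Notation at_l r := (map_poly (horner_eval l) r).

Lemma at_inner_linP : sg (linP a b) = a.[l]%:P%:P * 'X + phi%:P.
Proof. by rewrite /linP rmorphD rmorphM at_innerC at_innerZ at_inner_C. Qed.

Lemma at_inner_evP r : sg (evP a b r) = ev1 (polyCC F) (sg (linP a b)) (at_l r).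
Proof.
rewrite /evP (@ev1_comp _ _ _ _ _ _ (polyCC F \o horner_eval l)) => [|c].
  by rewrite (@ev1_map _ _ _ _ _ _ (polyCC F \o horner_eval l)).
exact: at_innerC.
Qed.

Lemma ev1_polyCC (p r : {poly F}) : ev1 (polyCC F) r%:P p = (p \Po r)%:P.
Proof. by rewrite -ev1_polyC (@ev1_comp _ _ _ _ _ _ (polyCC F)). Qed.

Hypothesis al : a.[l] = 0.

Lemma at_root_linP : sg (linP a b) = phi%:P.
Proof. by rewrite at_inner_linP al !polyC0 mul0r add0r. Qed.

Lemma at_root_evP r : sg (evP a b r) = (at_l r \Po phi)%:P.
Proof. by rewrite at_inner_evP at_root_linP ev1_polyCC. Qed.

Hypothesis a0 : a != 0.
Hypothesis phi2 : (2 < size phi)%N.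
Variables (u v w : B) (U : {poly {poly F}}).
Hypothesis uU : u = evP a b U.
Hypothesis gen_uvw : forall r, exists h, r = ev3 (iC F) u v w h.

Lemma bad_fibre_coordinate : dy u = 0 /\ dz u = 0.
Proof.
apply: NNPP => nu.
have c0x := char0_poly char0; have c0y := char0_poly c0x.
pose y0 : {rmorphism {poly {poly F}} -> {poly F}} := map_poly (horner_eval 0).
(* On x = l the polynomial P restricts to phi(y), so on the line x = l, y = 0 it is the constant
   phi(0) and u is the constant [m]. The morphism [e] below is restriction to that line, with
   parameter z. *)
pose m := (at_l U).[phi.[0]].
have y0C (c : {poly F}) : y0 c%:P = c.[0]%:P by rewrite /y0 /= map_polyC.
have epsP r : y0 (sg (evP a b r)) = ((at_l r).[phi.[0]])%:P.
  by rewrite at_root_evP y0C horner_comp.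
have [q [qsurj qker qev]] := coordinate_quotient char0 m gen_uvw.
pose e : {rmorphism B -> {poly F}} := y0 \o sg.
have eE r : e r = y0 (sg r) by [].
have eC (c : F) : e c%:P%:P%:P = c%:P by rewrite eE at_innerC hornerC y0C hornerC.
have eu : e u = m%:P by rewrite uU eE epsP.
have {qev} eq_ r := qev e eC eu r.
(* If u - m divided a nonzero polynomial in x, it would itself lie in F[x], against [nu]. *)
have qnv (c : {poly F}) : c != 0 -> q c%:P%:P != 0.
  move=> cn; apply/negP => /eqP/qker[s es]; apply: nu.
  have [k [k' [ek _ ekk]]] := mul_eq_polyC (R := {poly {poly F}}) (c := c%:P) ltac:(by rewrite polyC_eq0) (esym es).
  have [k2 [_ [ek2 _ _]]] := mul_eq_polyC cn ekk.
  have -> : u = (k2 + m%:P)%:P%:P.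
    by rewrite !polyCD -ek2 -ek subrK.
  by rewrite dyCC dzC.
(* The restriction of z is a polynomial in [e v] and [e w], so these are not both constant. *)
have nonconst : (1 < size (e v))%N \/ (1 < size (e w))%N.
  have [sv|] := leqP (size (e v)) 1; last by left.
  have [sw|] := leqP (size (e w)) 1; last by right.
  exfalso; have : e 'X = 'X.
    by rewrite eE at_innerZ /y0 /= map_polyX.
  rewrite eq_.
  have [c ->] : exists c, ev2 (e v) (e w) (q 'X) = polyC c.
    apply: ev1_im => [c|]; last by exists (e w)`_0; apply: size1_polyC.
    apply: ev1_im => [d|]; first by exists d.
    by exists (e v)`_0; apply: size1_polyC.
  by move/(congr1 (size : {poly F} -> nat)); rewrite size_polyX size_polyC; case: (c != 0).
have [p hp] := ev2_kernel_principal nonconst.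
pose X1 : B := ('X - l%:P)%:P%:P.
have eX1 : e X1 = 0 by rewrite eE at_innerC hornerXsubC subrr y0C hornerC.
have qX1 : q X1 != 0 by apply: qnv; rewrite polyXsubC_eq0.
have [t qt] : exists t, q X1 = t * p by apply/hp; rewrite -eq_.
have [r qr] := qsurj p; have [r' qr'] := qsurj t.
pose D := Dab a b; have hD := ders_Dab a b.
have Dum : D (u - m%:P%:P%:P) = 0.
  have -> : u - m%:P%:P%:P = evP a b (U - m%:P%:P) by rewrite rmorphB -uU evP_C.
  exact: Dab_evP.
have stable s : q s = 0 -> q (D s) = 0.
  by move=> /qker[s' ->]; apply/qker; exists (D s'); exact: (ders_linear hD).
(* Modulo u - m, [r] divides x - l, which is nonzero there and killed by [D]. *)
have qDr : q (D r) = 0.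
  apply: (factorially_closed hD c0y (nilp_Dab a b) stable (s := r')).
    have -> : r * r' = (r * r' - X1) + X1 by rewrite subrK.
    case: (hD) => DD _; rewrite (DD (r * r' - X1) X1) (Dab_x a b) addr0; apply: stable.
    by rewrite rmorphB rmorphM qr qr' qt mulrC subrr.
  by rewrite rmorphM qr qr' mulrC -qt.
have [n [h eh]] := clear_denominators a b r.
pose g : {rmorphism {poly {poly F}} -> {poly {poly F}}} := q \o evP a b.
have qevPy s : q (evPy a b s) = (map_poly g s).[q 'X%:P].
  rewrite -ev1E.
  by apply: ev1_comp.
(* The iterates of [D] on [r] vanish modulo u - m, hence so do the positive y-derivatives of [h] at
   (x, P, y). Taylor expansion leaves the coefficient at y^0, an element of F[x, P]. *)
have q_an : q ((a ^+ n)%:P%:P * r) = q (evP a b h`_0).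
  have top i : (map_poly g h)^`(i.+1).[q 'X%:P] = 0.
    rewrite derivn_map -qevPy.
    have : q (iter i.+1 D (evPy a b h)) = 0.
      rewrite -eh (iter_ders_linear hD _ (Dab_x a b _)) rmorphM.
      by rewrite iterSr (iter_stable stable) ?mulr0.
    rewrite iter_Dab_evPy rmorphM => /eqP; rewrite mulf_eq0 => /orP[|/eqP //].
    by rewrite (negbTE (qnv _ _)) // expf_neq0.
  by rewrite eh qevPy (taylor_const c0y top) coef_map.
(* Remove the factors x - l of the denominator. If c(l) = 0, then on x = l the restriction of rho(x,
   P) is a multiple of that of u - m, so [rho] minus a multiple of [Um] is divisible by x - l. *)
have [c [rho [cl crho]]] : exists (c : {poly F}) rho, c.[l] != 0 /\ q (c%:P%:P * r) = q (evP a b rho).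
  have an0 : a ^+ n != 0 by rewrite expf_neq0.
  move: (a ^+ n) an0 h`_0 q_an => c; have [k] := ubnP (size c).
  elim: k c => // k IH c; rewrite ltnS => sc cn rho crho.
  have [cl|] := eqVneq c.[l] 0; last by exists c, rho.
  have /factor_theorem[c1] : root c l by rewrite /root cl.
  rewrite mulrC => ec.
  have c1n : c1 != 0 by apply: contraNneq cn => c10; rewrite ec c10 mulr0.
  have /qker[s es] : q (evP a b rho - c%:P%:P * r) = 0 by rewrite rmorphB crho subrr.
  have erho : evP a b rho = (u - m%:P%:P%:P) * s + c%:P%:P * r by rewrite -es subrK.
  pose Um := U - m%:P%:P.
  have uUm : u - m%:P%:P%:P = evP a b Um by rewrite rmorphB -uU evP_C.
  have [t1 et1] : exists t1, at_l rho = at_l Um * t1.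
    have phi1 : (1 < size phi)%N by apply: ltnW.
    apply: (dvd_comp phi1 (s := (sg s)`_0)).
    move/(congr1 (fun x => (sg x)`_0)): erho; rewrite uUm rmorphD !rmorphM !at_root_evP.
    by rewrite at_innerC cl !polyC0 mul0r addr0 coefCM coefC.
  have [rho1 erho1] : exists rho1, rho - Um * map_poly polyC t1 = ('X - l%:P)%:P * rho1.
    apply: (map_poly_eq0_dvd (g := horner_eval l)) => [d|]; first exact: horner_eq0_dvd.
    by rewrite rmorphB rmorphM /= map_hornerK et1 subrr.
  apply: (IH c1 _ c1n rho1).
    apply: leq_trans sc; rewrite ec size_mul ?polyXsubC_eq0 // size_XsubC.
    by rewrite addSn addSn add0n /=.
  have qum : q (evP a b Um) = 0 by rewrite -uUm; apply/qker; exists 1; rewrite mulr1.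
  have E1 : q (evP a b (Um * map_poly polyC t1)) = 0.
    by rewrite (rmorphM (evP a b)); exact: rmorph_mul0.
  have E2 : evP a b (('X - l%:P)%:P * rho1) = X1 * evP a b rho1.
    by rewrite (rmorphM (evP a b)); congr (_ * _); exact: evP_C.
  have E3 : X1 * (c1%:P%:P * r) = c%:P%:P * r.
    by rewrite mulrA; congr (_ * _); rewrite ec; exact/esym/polyCCM.
  have E4 : evP a b rho = evP a b (Um * map_poly polyC t1) + X1 * evP a b rho1.
    by rewrite -E2 -(rmorphD (evP a b)) -erho1 addrC subrK.
  apply: (mulfI qX1); rewrite -(rmorphM q X1 (c1%:P%:P * r)) E3 crho E4.
  by rewrite (rmorphD q) E1 add0r; exact: rmorphM.
have er : e r = 0 by rewrite eq_ qr; apply/hp; exists 1; rewrite mul1r.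
(* Both u - m and [r] vanish on the line. On x = l the first is a polynomial in phi, and so is the
   second modulo the first, up to a nonzero constant; vanishing at phi(0) makes both multiples of
   psi. *)
pose psi : {poly F} := phi - (phi.[0])%:P.
have spsi : size psi = size phi.
  by rewrite /psi size_polyDl // size_polyN size_polyC; case: (_ != 0); rewrite ltnW // ltnW.
have psi_dvd d : d.[phi.[0]] = 0 -> exists d', d \Po phi = psi * d'.
  move=> /rootP/factor_theorem[d' ->]; exists (d' \Po phi).
  by rewrite comp_polyM comp_polyB comp_polyX comp_polyC mulrC.
have um0 : exists d', sg (u - m%:P%:P%:P) = (psi * d')%:P.
  have [|d' ed] := psi_dvd (at_l U - m%:P); first by rewrite hornerD hornerN hornerC subrr.
  exists d'; rewrite -ed comp_polyB comp_polyC rmorphB at_innerC hornerC uU at_root_evP.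
  by rewrite -polyCB.
have [d1 ed1] := um0.
have [d2 ed2] : exists d2, sg r = psi%:P * d2.
  have /qker[s es] : q (c%:P%:P * r - evP a b rho) = 0 by rewrite rmorphB crho subrr.
  have ecr : c%:P%:P * r = (u - m%:P%:P%:P) * s + evP a b rho by rewrite -es subrK.
  have rho0 : (at_l rho).[phi.[0]] = 0.
    apply: polyC_inj; rewrite -epsP -eE.
    have eum : e (u - m%:P%:P%:P) = 0 by rewrite rmorphB eu eC subrr.
    by have := congr1 e ecr; rewrite rmorphD !rmorphM er eum mulr0 mul0r add0r => <-; rewrite polyC0.
  have [d' ed'] := psi_dvd _ rho0.
  have := congr1 sg ecr; rewrite rmorphD !rmorphM at_innerC ed1 at_root_evP ed' => E.
  exists ((c.[l]^-1)%:P%:P * (d1%:P * sg s + d'%:P)).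
  have -> : sg r = (c.[l]^-1)%:P%:P * ((c.[l])%:P%:P * sg r).
    by rewrite mulrA -!polyCM mulVf // !polyC1 mul1r.
  rewrite E !polyCM; ring.
(* y also vanishes on the line, so it lies in the ideal generated by [r] and u - m. On x = l this
   would make psi, of degree at least 2, divide y. *)
have eY : e 'X%:P = 0 by rewrite eE at_innerY y0C hornerX.
have [t2 et2] : exists t2, q 'X%:P = t2 * p by apply/hp; rewrite -eq_.
have [r2 er2] := qsurj t2.
have /qker[s es] : q ('X%:P - r2 * r) = 0 by rewrite rmorphB rmorphM er2 qr et2 subrr.
have : (sg 'X%:P)`_0 = psi * (d1 * (sg s)`_0 + ((sg r2) * d2)`_0).
  have -> : 'X%:P = (u - m%:P%:P%:P) * s + r2 * r by rewrite -es subrK.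
  rewrite rmorphD !rmorphM ed1 ed2 coefD coefCM.
  by rewrite [sg r2 * _]mulrCA coefCM mulrDr mulrA.
rewrite at_innerY coefC /= => eX.
have : (size psi <= size ('X : {poly F}))%N.
  by apply: dvdp_leq; rewrite ?polyX_eq0 // eX dvdp_mulr.
by rewrite size_polyX spsi leqNgt phi2.
Qed.

End BadFibre.

(** * Field extensions and descent *)

(* An R-linear map [t] back along [i]; with [t 1 = 1] it descends solutions of linear systems from S to R. *)
Definition retraction (R S : comNzRingType) (i : {rmorphism R -> S}) (t : S -> R) : Prop :=
  (forall x y, t (x + y) = t x + t y) /\ (forall x r, t (x * i r) = t x * r).

Lemma retraction0 (R S : comNzRingType) (i : {rmorphism R -> S}) t :
  retraction i t -> t 0 = 0.
Proof. by case=> _ /(_ 0 0); rewrite mul0r mulr0. Qed.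

Lemma retraction_poly (R S : comNzRingType) (i : {rmorphism R -> S}) t :
  retraction i t -> retraction (map_poly i : {rmorphism _ -> _}) (map_poly t).
Proof.
move=> ht; have t0 := retraction0 ht; case: ht => tD tM.
have tS I r (P : pred I) E : t (\sum_(i <- r | P i) E i) = \sum_(i <- r | P i) t (E i).
  exact: (big_morph t tD t0).
split=> x y; apply/polyP=> k.
  by rewrite coefD !coef_map_id0 // coefD tD.
rewrite coef_map_id0 // !coefM tS.
by apply: eq_bigr => j _; rewrite coef_map tM coef_map_id0.
Qed.

Lemma root_extension (K : fieldType) (c : {poly K}) : (1 < size c)%N ->
  exists (E : fieldType) (i : {rmorphism K -> E}) (t : E -> K) (l : E),
    [/\ retraction i t, t 1 = 1 & (map_poly i c).[l] = 0].
Proof.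
move=> /irreducible_divisor[p irr /dvdpP[c' ->]].
have [L _ [z rz _]] := irredp_FAdjoin irr.
(* The coordinate along the free family (1) is a K-linear form on [L] with value 1 at 1. *)
exists L, (in_alg L : {rmorphism K -> L}), (coord [tuple (1 : L)] ord0), z; split.
- split=> x y; first exact: linearD.
  by rewrite /= -scalerAr mulr1 linearZ /= mulrC.
- have := @coord_free K L 1 [tuple (1 : L)] ord0 ord0.
  by rewrite eqxx /=; apply; rewrite /= seq1_free oner_eq0.
- by apply/eqP; rewrite rmorphM hornerM mulf_eq0; apply/orP; right; exact: rz.
Qed.

(** A retraction may kill a polynomial; dividing first by the leading coefficient makes the top
    coefficient 1, which [t] preserves. *)
Lemma retraction_lead (K E : fieldType) (i : {rmorphism K -> E}) (t : E -> K) (c : {poly E}) :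
  retraction i t -> t 1 = 1 -> c != 0 ->
  exists2 e : E, e != 0 & map_poly t (e%:P * c) != 0 /\
    (size (map_poly t (e%:P * c)) <= size c)%N.
Proof.
move=> ht t1 cn; have t0 := retraction0 ht.
exists (lead_coef c)^-1; first by rewrite invr_eq0 lead_coef_eq0.
have lc : (lead_coef c)^-1 * lead_coef c = 1 by rewrite mulVf // lead_coef_eq0.
split; last first.
  apply/leq_sizeP => j sj; rewrite coef_map_id0 // coefCM nth_default //.
  by rewrite mulr0.
apply/eqP => /polyP/(_ (size c).-1); rewrite coef_map_id0 // coefCM coef0.
by rewrite -lead_coefE lc t1 => /eqP; rewrite oner_eq0.
Qed.

Lemma antiderivative (R : comNzRingType) : (forall k : nat, exists c : R, c * k.+1%:R = 1) ->
  forall p : {poly R}, exists q, q^`() = p.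
Proof.
move=> hR p; rewrite -[p]coefK poly_def.
apply: (big_ind (fun p : {poly R} => exists q, q^`() = p)).
- by exists 0; rewrite deriv0.
- by move=> _ _ [q <-] [r <-]; exists (q + r); rewrite derivD.
move=> j _; have [c hc] := hR j; exists ((c * p`_j) *: 'X^(j.+1)).
rewrite derivZ derivXn /= -scaler_nat scalerA; congr (_ *: _).
by rewrite mulrAC hc mul1r.
Qed.

Lemma natr_inv_poly (R : comNzRingType) : (forall k : nat, exists c : R, c * k.+1%:R = 1) ->
  forall k : nat, exists c : {poly R}, c * k.+1%:R = 1.
Proof.
by move=> hR k; have [c hc] := hR k; exists c%:P; rewrite -polyC_natr -polyCM hc polyC1.
Qed.

Lemma natr_inv_field (K : fieldType) : (forall k : nat, k.+1%:R != 0 :> K) ->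
  forall k : nat, exists c : K, c * k.+1%:R = 1.
Proof. by move=> h k; exists (k.+1%:R)^-1; rewrite mulVf. Qed.

Lemma retraction_deriv (R S : comNzRingType) (i : {rmorphism R -> S}) t (p : {poly S}) :
  retraction i t -> map_poly t p^`() = (map_poly t p)^`().
Proof.
move=> ht; have t0 := retraction0 ht; case: ht => tD _.
apply/polyP=> k; rewrite coef_deriv !coef_map_id0 // coef_deriv.
by move: p`_k.+1 => y; elim: k.+1 => [|n IH]; rewrite ?mulr0n // !mulrSr tD IH.
Qed.

(** A z + phi(y) is nonconstant, hence transcendental over [F]. *)
Lemma comp_nonconst (F : fieldType) (A : F) (phi p : {poly F}) :
  A != 0 \/ (1 < size phi)%N -> ev1 (polyCC F) (A%:P%:P * 'X + phi%:P) p = 0 -> p = 0.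
Proof.
have [-> [//|sphi]|An _] := eqVneq A 0.
  rewrite !polyC0 mul0r add0r ev1_polyCC => /polyC_inj/eqP.
  by rewrite comp_poly_eq0 // => /eqP.
have sz : (1 < size (A%:P%:P * 'X + phi%:P : {poly {poly F}})%R)%N.
  by rewrite size_MXaddC polyC_eq0 polyC_eq0 (negbTE An) /= size_polyC polyC_eq0 An.
have -> : ev1 (polyCC F) (A%:P%:P * 'X + phi%:P) p = map_poly polyC p \Po (A%:P%:P * 'X + phi%:P).
  by rewrite -[RHS]/(ev1 polyC _ _) (@ev1_map _ _ _ _ _ _ (polyCC F)).
by move/eqP; rewrite comp_poly_eq0 // map_polyC_eq0 => /eqP.
Qed.

Section BaseChange.
Variables (K E : comNzRingType) (i : {rmorphism K -> E}) (t : E -> K).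
Hypothesis ht : retraction i t.

Definition bc1 : {rmorphism {poly K} -> {poly E}} := map_poly i.
Definition bc2 : {rmorphism {poly {poly K}} -> {poly {poly E}}} := map_poly bc1.
Definition bc3 : {rmorphism {poly {poly {poly K}}} -> {poly {poly {poly E}}}} :=
  map_poly bc2.
Definition rt1 : {poly E} -> {poly K} := map_poly t.
Definition rt2 : {poly {poly E}} -> {poly {poly K}} := map_poly rt1.
Definition rt3 : {poly {poly {poly E}}} -> {poly {poly {poly K}}} := map_poly rt2.

Lemma retraction1 : retraction bc1 rt1. Proof. exact: retraction_poly. Qed.
Lemma retraction2 : retraction bc2 rt2. Proof. exact: retraction_poly retraction1. Qed.
Lemma retraction3 : retraction bc3 rt3. Proof. exact: retraction_poly retraction2. Qed.

Lemma bc1C c : bc1 c%:P = (i c)%:P. Proof. exact: map_polyC. Qed.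
Lemma bc2C c : bc2 c%:P = (bc1 c)%:P. Proof. exact: map_polyC. Qed.
Lemma bc3C c : bc3 c%:P = (bc2 c)%:P. Proof. exact: map_polyC. Qed.
Lemma bc1X : bc1 'X = 'X. Proof. exact: map_polyX. Qed.
Lemma bc2X : bc2 'X = 'X. Proof. exact: map_polyX. Qed.
Lemma bc3X : bc3 'X = 'X. Proof. exact: map_polyX. Qed.

Lemma bc3_inj : injective i -> injective bc3.
Proof.
move=> inj; apply: (map_inj_poly _ (rmorph0 bc2)).
apply: (map_inj_poly _ (rmorph0 bc1)).
exact: (map_inj_poly inj (rmorph0 i)).
Qed.

Lemma rt1_0 : rt1 0 = 0. Proof. exact: retraction0 retraction1. Qed.
Lemma rt2_0 : rt2 0 = 0. Proof. exact: retraction0 retraction2. Qed.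
Lemma rt2C c : rt2 c%:P = (rt1 c)%:P. Proof. exact: map_polyC0 rt1_0. Qed.
Lemma rt3C c : rt3 c%:P = (rt2 c)%:P. Proof. exact: map_polyC0 rt2_0. Qed.

Lemma rt2_deriv p : rt2 p^`() = (rt2 p)^`().
Proof. exact: retraction_deriv retraction1. Qed.

Lemma rt3_dz r : rt3 (dz r) = dz (rt3 r).
Proof. by rewrite dz.unlock; exact: retraction_deriv retraction2. Qed.

Lemma rt3_dy r : rt3 (dy r) = dy (rt3 r).
Proof.
rewrite dy.unlock; apply/polyP=> k.
transitivity (rt2 (map_poly (@deriv _) r)`_k); first exact: coef_map_id0 _ _ rt2_0.
transitivity (((rt3 r)`_k)^`()); last first.
  by apply/esym; exact: (coef_map_id0 (f := @deriv {poly K}) _ _ (deriv0 _)).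
have -> : (map_poly (@deriv _) r)`_k = (r`_k)^`() by apply: coef_map_id0 _ _ (deriv0 _).
have -> : (rt3 r)`_k = rt2 r`_k by apply: coef_map_id0 _ _ rt2_0.
exact: rt2_deriv.
Qed.

Lemma bc3_dz r : bc3 (dz r) = dz (bc3 r).
Proof. by rewrite dz.unlock; exact/esym/deriv_map. Qed.

Lemma bc3_dy r : bc3 (dy r) = dy (bc3 r).
Proof.
rewrite dy.unlock; apply/polyP=> k.
transitivity (bc2 (map_poly (@deriv _) r)`_k); first exact: coef_map.
transitivity (((bc3 r)`_k)^`()); last first.
  by apply/esym; exact: (coef_map_id0 (f := @deriv {poly E}) _ _ (deriv0 _)).
have -> : (map_poly (@deriv _) r)`_k = (r`_k)^`() by apply: coef_map_id0 _ _ (deriv0 _).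
have -> : (bc3 r)`_k = bc2 r`_k by apply: coef_map.
exact/esym/deriv_map.
Qed.

Lemma retractionN (R S : comNzRingType) (j : {rmorphism R -> S}) s x :
  retraction j s -> s (- x) = - s x.
Proof. by case=> _ sM; rewrite -mulrN1 -(rmorphN1 j) sM mulrN1. Qed.

Lemma retractionMl (R S : comNzRingType) (j : {rmorphism R -> S}) s x r :
  retraction j s -> s (j r * x) = r * s x.
Proof. by case=> _ sM; rewrite mulrC sM mulrC. Qed.

Lemma rt3_lin (k1 k2 : {poly {poly {poly K}}}) x1 x2 :
  rt3 (bc3 k1 * x1 - bc3 k2 * x2) = k1 * rt3 x1 - k2 * rt3 x2.
Proof.
have h3 := retraction3; have [tD _] := h3.
by rewrite tD (retractionN _ h3) !(retractionMl _ _ h3).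
Qed.

Variables (a : {poly K}) (b : {poly {poly K}}).
Notation aE := (bc1 a).
Notation bE := (bc2 b).

Lemma bc2_deriv p : bc2 p^`() = (bc2 p)^`().
Proof. exact/esym/deriv_map. Qed.

Lemma bc3_a : bc3 a%:P%:P = aE%:P%:P. Proof. by rewrite bc3C bc2C. Qed.
Lemma bc3_b' : bc3 (b^`())%:P = (bE^`())%:P. Proof. by rewrite bc3C bc2_deriv. Qed.

Lemma rt3_Dab r : rt3 (Dab aE bE r) = Dab a b (rt3 r).
Proof. by rewrite !DabE -bc3_a -bc3_b' rt3_lin rt3_dy rt3_dz. Qed.

Lemma bc3_Dab r : bc3 (Dab a b r) = Dab aE bE (bc3 r).
Proof. by rewrite !DabE -bc3_a -bc3_b' -bc3_dy -bc3_dz rmorphB !rmorphM. Qed.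

Lemma bc3_linP : bc3 (linP a b) = linP aE bE.
Proof. by rewrite /linP rmorphD rmorphM bc3_a bc3C bc3X. Qed.

Lemma bc3_evP r : bc3 (evP a b r) = evP aE bE (bc2 r).
Proof.
rewrite /evP (@ev1_comp _ _ _ _ _ _ (kx E \o bc1)) => [|c]; last exact: etrans (bc3C _) (congr1 _ (bc2C _)).
by rewrite bc3_linP (@ev1_map _ _ _ _ _ _ (kx E \o bc1)).
Qed.

Lemma rt3_evP r : rt3 (evP aE bE r) = evP a b (rt2 r).
Proof.
have [t2D t2M] := retraction2; have [t3D t3M] := retraction3.
elim/poly_ind: r => [|r c IH]; first by rewrite rt2_0 !rmorph0; exact: retraction0 retraction3.
rewrite t2D -{2}bc2X t2M rt2C rmorphD rmorphM evP_X evP_C -bc3_linP t3D t3M IH rt3C rt2C.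
by rewrite rmorphD rmorphM evP_X evP_C.
Qed.

Lemma ev3_id (R : comNzRingType) (r : {poly {poly {poly R}}}) :
  ev3 (iC R) 'X%:P%:P 'X%:P 'X r = r.
Proof.
have hC (c : R) : ev3 (iC R) 'X%:P%:P 'X%:P 'X c%:P%:P%:P = c%:P%:P%:P by exact: ev3C.
have hX : ev3 (iC R) 'X%:P%:P 'X%:P 'X 'X%:P%:P = 'X%:P%:P by exact: ev3X.
have hY : ev3 (iC R) 'X%:P%:P 'X%:P 'X 'X%:P = 'X%:P by exact: ev3Y.
have hZ : ev3 (iC R) 'X%:P%:P 'X%:P 'X 'X = 'X by exact: ev3Z.
exact: (@ev3_ext _ _ (ev3 (iC R) 'X%:P%:P 'X%:P 'X) idfun hC hX hY hZ).
Qed.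

(** The variables are already polynomials in u, v, w over [K], and these expressions carry over to
    [E]. *)
Lemma bc_gen (u v w : {poly {poly {poly K}}}) :
  (forall r, exists h, r = ev3 (iC K) u v w h) ->
  forall r, exists h, r = ev3 (iC E) (bc3 u) (bc3 v) (bc3 w) h.
Proof.
move=> gen.
have up (s : {poly {poly {poly K}}}) : exists h, bc3 s = ev3 (iC E) (bc3 u) (bc3 v) (bc3 w) h.
  have [h ->] := gen s.
  exists (bc3 h); rewrite /ev3 /bc3.
  pose i1 : {rmorphism {poly K} -> {poly {poly {poly E}}}} := ev1 (iC E) (bc3 u) \o bc1.
  pose i2 : {rmorphism {poly {poly K}} -> {poly {poly {poly E}}}} :=
    ev1 (ev1 (iC E) (bc3 u)) (bc3 v) \o bc2.
  rewrite (@ev1_map _ _ _ _ _ _ i2) // -/bc3.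
  apply: ev1_comp => c; rewrite /i2 -[RHS]/(ev1 (ev1 (iC E) (bc3 u)) (bc3 v) (map_poly bc1 c)).
  rewrite (@ev1_map _ _ _ _ _ _ i1) //.
  apply: ev1_comp => d; rewrite /i1 -[RHS]/(ev1 (iC E) (bc3 u) (map_poly i d)).
  rewrite (@ev1_map _ _ _ _ _ _ (iC E \o i)) //.
  apply: ev1_comp => k; rewrite -[LHS]/(bc3 k%:P%:P%:P) bc3C bc2C bc1C //.
move=> r; rewrite -[r]ev3_id.
have [hX eX] := up 'X%:P%:P; have [hY eY] := up 'X%:P; have [hZ eZ] := up 'X.
apply: ev1_im => [c|]; last by exists hZ; rewrite -eZ bc3X.
apply: ev1_im => [d|]; last by exists hY; rewrite -eY bc3C bc2X.
apply: ev1_im => [k|]; last by exists hX; rewrite -eX bc3C bc2C bc1X.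
by exists k%:P%:P%:P; rewrite ev3C.
Qed.

End BaseChange.

(** * Kernel and slice *)

Lemma char0_ext (K E : fieldType) (i : {rmorphism K -> E}) :
  (forall k : nat, k.+1%:R != 0 :> K) -> forall k : nat, k.+1%:R != 0 :> E.
Proof. by move=> c0 k; rewrite -(rmorph_nat i) fmorph_eq0. Qed.

Lemma const_inverse (K : fieldType) (c : {poly K}) : c != 0 -> (size c <= 1)%N ->
  exists e : K, e%:P * c = 1.
Proof.
move=> cn /size1_polyC ec; exists (c`_0)^-1; rewrite {2}ec -polyCM mulVf //.
by apply: contraNneq cn => c0; rewrite ec c0.
Qed.

Lemma polyCC1 (R : nzRingType) : (1 : R)%:P%:P = 1.
Proof. exact: etrans (congr1 polyC (polyC1 R)) (polyC1 _). Qed.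

Section MinimalKernelElement.
Variable K : fieldType.
Hypothesis char0 : forall k : nat, k.+1%:R != 0 :> K.
Notation B := {poly {poly {poly K}}}.
Variables (f : {poly K}) (g : {poly {poly K}}) (a : {poly K}) (b : {poly {poly K}}).
Hypothesis an : a != 0.
(** P = a z + b is killed by f d/dy + g d/dz, and [amin] gives [a] the least degree for this. *)
Hypothesis hP : a%:P * g + f%:P * b^`() = 0.
Hypothesis amin : forall a' b', a' != 0 -> a'%:P * g + f%:P * b'^`() = 0 ->
  (size a <= size a')%N.
Notation D := (Dab a b).
Notation P := (linP a b).

Lemma root_linear_factor (E : fieldType) (c : {poly E}) (l : E) : c != 0 -> c.[l] = 0 ->
  exists c1, [/\ c1 != 0, c = ('X - l%:P) * c1 & (size c1 < size c)%N].
Proof.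
move=> cn cl; have /factor_theorem[c1 ec] : root c l by rewrite /root cl.
have c1n : c1 != 0 by apply: contraNneq cn => c10; rewrite ec c10 mul0r.
exists c1; rewrite mulrC; split=> //.
by rewrite ec size_mul ?polyXsubC_eq0 // size_XsubC addnS addn1.
Qed.

Section Extension.
Variables (E : fieldType) (i : {rmorphism K -> E}) (t : E -> K) (l : E).
Hypothesis ht : retraction i t.
Hypothesis t1 : t 1 = 1.
Notation phi := (map_poly (horner_eval l) (bc2 i b)).

(** If b(l, y) were constant, P minus that constant would be divisible by x - l over [E]. The
    quotient, scaled and retracted to [K], would contradict the minimality of [a]. *)
Lemma fibre_nonconst : (bc1 i a).[l] = 0 -> (1 < size phi)%N.
Proof.
move=> al; rewrite ltnNge; apply/negP => /size1_polyC ephi.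
have aEn : bc1 i a != 0 by rewrite map_poly_eq0.
have [a1 [a1n ea1 sa1]] := root_linear_factor aEn al.
have [b1 eb1] : exists b1, bc2 i b - (phi`_0)%:P%:P = ('X - l%:P)%:P * b1.
  apply: (map_poly_eq0_dvd (g := horner_eval l)) => [d|]; first exact: horner_eq0_dvd.
  by rewrite rmorphB /= map_polyC /= {1}ephi /horner_eval hornerC subrr.
have eb1' : (bc2 i b)^`() = ('X - l%:P)%:P * b1^`().
  by move/(congr1 (@deriv _)): eb1; rewrite derivB !derivM !derivC subr0 mul0r add0r.
have h1 : a1%:P * bc2 i g + (bc1 i f)%:P * b1^`() = 0.
  have Xn : ('X - l%:P)%:P != 0 :> {poly {poly E}} by rewrite polyC_eq0 polyXsubC_eq0.
  apply: (mulfI Xn); rewrite mulr0 mulrDr mulrA -polyCM -ea1 mulrCA -eb1'.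
  by rewrite -bc2_deriv -!bc2C -!rmorphM -rmorphD hP rmorph0.
have [e en [te ts]] := retraction_lead ht t1 a1n.
have [t2D t2M] := retraction2 ht.
have : (size a <= size (rt1 t (e%:P * a1)%R))%N.
  apply: (amin (b' := rt2 t (e%:P%:P * b1))) => //.
  rewrite -(rt2_deriv ht) derivM derivC mul0r add0r -(rt2C ht).
  rewrite [f%:P * _]mulrC -!t2M -t2D bc2C polyCM.
  rewrite -!mulrA -mulrDr [b1^`() * _]mulrC h1 mulr0.
  exact: rt2_0 ht.
rewrite leqNgt; apply/negP; rewrite negbK.
apply: (leq_ltn_trans ts); apply: (leq_trans sa1); rewrite size_map_poly //.
Qed.

(** P(l, y, z) depends on y if l is a root of [a], and on z otherwise. *)
Lemma fibre_linP_nonconst (r : {poly E}) :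
  ev1 (polyCC E) (at_inner l (linP (bc1 i a) (bc2 i b))) r = 0 -> r = 0.
Proof.
rewrite at_inner_linP; apply: comp_nonconst.
by have [/fibre_nonconst|] := eqVneq (bc1 i a).[l] 0; [right|left].
Qed.

End Extension.

(* Roots of the denominator [c] are removed one at a time, over an extension containing the root. *)
Lemma kernel_generated (r : B) : D r = 0 -> exists rho, r = evP a b rho.
Proof.
move=> Dr; have hD := ders_Dab a b.
have c0x := char0_poly char0; have c0y := char0_poly c0x; have c0z := char0_poly c0y.
have [n [h eh]] := clear_denominators a b r.
(* As [D r = 0], the positive y-derivatives of [h] vanish at (x, P, y), and only its coefficient at
   y^0 remains. *)
have e0 : (a ^+ n)%:P%:P * r = evP a b h`_0.
  have ev s : evPy a b s = (map_poly (evP a b) s).['X%:P] by [].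
  have top j : (map_poly (evP a b) h)^`(j.+1).['X%:P] = 0.
    rewrite derivn_map -ev.
    have : iter j.+1 D (evPy a b h) = 0.
      rewrite -eh (iter_ders_linear hD _ (Dab_x a b _)) iterSr Dr (iter_ders0 hD).
      exact: mulr0.
    rewrite iter_Dab_evPy => /eqP; rewrite mulf_eq0 => /orP[|/eqP //].
    by rewrite !polyC_eq0 expf_eq0 (negbTE an) andbF.
  by rewrite eh ev (taylor_const c0z top) coef_map.
have an0 : a ^+ n != 0 by rewrite expf_neq0.
move: (a ^+ n) an0 h`_0 e0 => c {n h eh}; have [k] := ubnP (size c).
elim: k c => // k IH c; rewrite ltnS => sc cn rho e0.
have [c1|cgt1] := leqP (size c) 1.
  have [e ec] := const_inverse cn c1.
  exists (e%:P%:P * rho); rewrite (rmorphM (evP a b)) -e0 evP_C mulrA -polyCCM.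
  by rewrite ec polyCC1 mul1r.
have [E [i [t [l [ht t1 cl]]]]] := root_extension cgt1.
have cEn : bc1 i c != 0 by rewrite map_poly_eq0.
have [c1 [c1n ec1 sc1]] := root_linear_factor cEn cl.
have eE : (bc1 i c)%:P%:P * bc3 i r = evP (bc1 i a) (bc2 i b) (bc2 i rho).
  by rewrite -bc3_evP -e0 (rmorphM (bc3 i)) bc3_a.
(* rho(l, P(l, y, z)) = c(l) r(l, y, z) = 0 and P(l, y, z) is nonconstant, so rho vanishes at x =
   l. *)
have [rho1 erho1] : exists rho1, bc2 i rho = ('X - l%:P)%:P * rho1.
  apply: (map_poly_eq0_dvd (g := horner_eval l)) => [d|]; first exact: horner_eq0_dvd.
  apply: (fibre_linP_nonconst ht t1 (l := l)); rewrite -at_inner_evP -eE.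
  by rewrite (rmorphM (at_inner l)) at_innerC cl !polyC0 mul0r.
have [e en [te ts]] := retraction_lead ht t1 c1n.
have eE1 : c1%:P%:P * bc3 i r = evP (bc1 i a) (bc2 i b) rho1.
  have Xn : ('X - l%:P)%:P%:P != 0 :> {poly {poly {poly E}}} by rewrite !polyC_eq0 polyXsubC_eq0.
  apply: (mulfI Xn); rewrite mulrA.
  have <- : (bc1 i c)%:P%:P = ('X - l%:P)%:P%:P * c1%:P%:P :> {poly {poly {poly E}}}.
    by rewrite ec1; exact: polyCCM.
  by rewrite eE erho1 (rmorphM (evP _ _)) evP_C.
apply: (IH (rt1 t (e%:P * c1)) _ te (rt2 t (e%:P%:P * rho1))).
  apply: (leq_ltn_trans ts); apply: (leq_trans sc1); rewrite size_map_poly //.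
have [_ t3M] := retraction3 ht.
by rewrite -(rt3_evP ht) (rmorphM (evP _ _)) evP_C -eE1 mulrA -polyCCM t3M (rt3C ht) (rt2C ht).
Qed.

Variables (u v w : B).
Hypothesis gen_uvw : forall r, exists h, r = ev3 (iC K) u v w h.
Hypothesis Du : D u = 0.
Hypothesis nu : ~ (dy u = 0 /\ dz u = 0).

(** Start from D y = a and lower the degree of c in D T = c(x) until it is constant: at a root l of
    c, subtract from T a kernel element that agrees with it on x = l, divide by x - l, and retract
    to [K]. *)
Lemma slice_exists : exists s, D s = 1.
Proof.
have [U eU] := kernel_generated Du.
have hD := ders_Dab a b; have [DD DM] := hD.
suff main : forall (c : {poly K}) T, c != 0 -> D T = c%:P%:P -> exists s, D s = 1.
  exact: main a 'X%:P an (Dab_y a b).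
move=> c; have [k] := ubnP (size c); elim: k c => // k IH c; rewrite ltnS => sc T cn eT.
(* Passing to the gcd with [a], by combining T and y, makes every root of the new c a root of
   [a]. *)
have [[m n] /= hg] := Bezoutp c a.
set c2 := m * c + n * a in hg.
have c2a : c2 %| a by rewrite (eqp_dvdl _ hg) dvdp_gcdr.
have c2c : c2 %| c by rewrite (eqp_dvdl _ hg) dvdp_gcdl.
have c2n : c2 != 0 by apply: contraNneq cn => c20; move: c2c; rewrite c20 dvd0p.
have [T2 eT2] : exists T2, D T2 = c2%:P%:P.
  exists (m%:P%:P * T + n%:P%:P * 'X%:P).
  rewrite (DD (m%:P%:P * T) (n%:P%:P * 'X%:P)) !(ders_linear hD (Dab_x a b _)) eT Dab_y.
  by rewrite -!polyCCM -!polyCD.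
have sc2 : (size c2 <= k)%N by apply: leq_trans sc; exact: dvdp_leq.
have [c1|cgt1] := leqP (size c2) 1.
  have [e ec] := const_inverse c2n c1.
  exists (e%:P%:P%:P * T2); rewrite (ders_linear hD (Dab_x a b _)) eT2 -polyCCM ec.
  exact: polyCC1.
have [E [i [t [l [ht t1 cl]]]]] := root_extension cgt1.
have c0E := char0_ext i char0; have c0x := char0_poly c0E; have c0y := char0_poly c0x.
have al : (bc1 i a).[l] = 0.
  by have /dvdpP[a' ->] := c2a; rewrite /bc1 rmorphM hornerM cl mulr0.
pose phi := map_poly (horner_eval l) (bc2 i b).
have phi1 : (1 < size phi)%N := fibre_nonconst ht t1 al.
(* Degree at least 2 would put u into K[x], against [nu]; so b(l, y) has degree 1. *)
have phi2 : (size phi <= 2)%N.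
  rewrite leqNgt; apply/negP => phi2; apply: nu.
  have aEn : bc1 i a != 0 by rewrite map_poly_eq0.
  have uE : bc3 i u = evP (bc1 i a) (bc2 i b) (bc2 i U) by rewrite eU bc3_evP.
  have [dyu dzu] := bad_fibre_coordinate c0E al aEn phi2 uE (bc_gen i gen_uvw).
  by split; apply: (bc3_inj (fmorph_inj i)); rewrite rmorph0 ?bc3_dy ?bc3_dz.
pose TE := bc3 i T2.
have eTE : Dab (bc1 i a) (bc2 i b) TE = (bc1 i c2)%:P%:P by rewrite -bc3_Dab eT2 bc3_a.
pose al1 := phi`_1; pose be := phi`_0.
have ephi : phi = al1%:P * 'X + be%:P.
  apply/polyP => -[|[|j]]; rewrite coefD coefCM coefX coefC /= ?mulr0 ?mulr1 ?add0r ?addr0 //.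
  by rewrite nth_default // (leq_trans phi2).
have al1n : al1 != 0.
  by apply: contraTneq phi1 => al0; rewrite ephi al0 polyC0 mul0r add0r size_polyC; case: (be != 0).
have dphi : phi^`() = al1%:P by rewrite ephi derivD derivM derivX !derivC mul0r add0r mulr1 addr0.
(* On x = l the derivation becomes -phi' d/dz with phi' a nonzero constant, so the restriction of T
   does not involve z. *)
have sgT : (at_inner l TE)^`() = 0.
  have : at_inner l (Dab (bc1 i a) (bc2 i b) TE) = 0.
    by rewrite eTE at_innerC [X in X%:P](_ : _ = 0) ?polyC0 //; exact: (congr1 polyC cl).
  rewrite DabE rmorphB !rmorphM at_innerC al !polyC0 mul0r sub0r => /eqP.
  rewrite oppr_eq0 mulf_eq0 at_inner_C -deriv_map -/phi dphi !polyC_eq0 (negbTE al1n) /=.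
  by rewrite dz.unlock -deriv_map => /eqP.
have /(deriv_eq0 c0x) := sgT; set tau := _`_0 => etau.
(* As y = (phi - be) / al1, the restriction of T is a polynomial in phi, which is P on x = l. *)
pose tau1 := tau \Po (al1^-1%:P * ('X - be%:P)).
have etau1 : tau1 \Po phi = tau.
  rewrite /tau1 -comp_polyA comp_polyM comp_polyB comp_polyX !comp_polyC ephi addrK mulrA.
  by rewrite -polyCM mulVf // mul1r comp_polyXr.
have [T1 eT1] : exists T1, TE - evP (bc1 i a) (bc2 i b) (map_poly polyC tau1) = ('X - l%:P)%:P%:P * T1.
  apply: at_inner_eq0; rewrite (rmorphB (at_inner l)) at_root_evP // map_hornerK -/phi etau1.
  by rewrite etau subrr.
have cEn : bc1 i c2 != 0 by rewrite map_poly_eq0.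
have [c1 [c1n ec1 sc1]] := root_linear_factor cEn cl.
have hDE := ders_Dab (bc1 i a) (bc2 i b).
have eD1 : Dab (bc1 i a) (bc2 i b) T1 = c1%:P%:P.
  have Xn : ('X - l%:P)%:P%:P != 0 :> {poly {poly {poly E}}} by rewrite !polyC_eq0 polyXsubC_eq0.
  apply: (mulfI Xn); rewrite -(ders_linear hDE (Dab_x _ _ _)) -eT1 -polyCCM -ec1.
  have [DDE _] := hDE.
  have := DDE (TE - evP (bc1 i a) (bc2 i b) (map_poly polyC tau1)) (evP (bc1 i a) (bc2 i b) (map_poly polyC tau1)).
  by rewrite subrK Dab_evP addr0 eTE => <-.
have [e en [te ts]] := retraction_lead ht t1 c1n.
apply: (IH (rt1 t (e%:P * c1)) _ (rt3 t (e%:P%:P%:P * T1)) te).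
  apply: (leq_ltn_trans ts); apply: (leq_trans sc1); rewrite size_map_poly //.
by rewrite -(rt3_Dab ht) (ders_linear hDE (Dab_x _ _ _)) eD1 -polyCCM (rt3C ht) (rt2C ht).
Qed.

End MinimalKernelElement.

Lemma ev1_eq (R T : comNzRingType) (g h : {rmorphism R -> T}) t p :
  g =1 h -> ev1 g t p = ev1 h t p.
Proof. by move=> gh; exact: (@ev1_comp _ _ _ g t idfun h). Qed.

Lemma ev3_comp (K S T : comNzRingType) (i : {rmorphism K -> S}) (j : {rmorphism K -> T})
    (g : {rmorphism S -> T}) x y z h :
  (forall c, g (i c) = j c) -> g (ev3 i x y z h) = ev3 j (g x) (g y) (g z) h.
Proof. by move=> gi; apply: ev1_comp => c; apply: ev1_comp => d; apply: ev1_comp. Qed.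

Lemma ders_ev1 (R T : comNzRingType) (h : {rmorphism R -> T}) (d : T -> T) t p :
  is_der id d -> (forall x, d (h x) = 0) -> d (ev1 h t p) = ev1 h t p^`() * d t.
Proof.
move=> hd dh; have [dD dM] := hd.
elim/poly_ind: p => [|p c IH]; first by rewrite deriv0 !rmorph0 (ders0 hd) mul0r.
rewrite derivD derivM derivX derivC addr0 mulr1 !rmorphD !rmorphM ev1X ev1C dD dM dh IH.
by rewrite addr0; ring.
Qed.

Lemma lin001 (R : nzRingType) (x y z : R) : x * 0 + y * 0 + z * 1 = z.
Proof. by rewrite !mulr0 !add0r mulr1. Qed.

Section SliceGenerates.
Variable K : fieldType.
Hypothesis char0 : forall k : nat, k.+1%:R != 0 :> K.
Notation B := {poly {poly {poly K}}}.
Variables (a : {poly K}) (b : {poly {poly K}}).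
Notation D := (Dab a b).
Hypothesis kerD : forall r : B, D r = 0 -> exists rho, r = evP a b rho.

(** The slice theorem, by induction on the nilpotency index: integrate D r in the variable s and
    subtract; the rest lies in the kernel K[x, P]. *)
Lemma slice_generates (s : B) : D s = 1 ->
  forall r, exists h, r = ev3 (iC K) 'X%:P%:P (linP a b) s h.
Proof.
move=> Ds; set e := ev3 (iC K) 'X%:P%:P (linP a b) s.
have hD := ders_Dab a b; have [DD _] := hD.
have eC (c : K) : e c%:P%:P%:P = c%:P%:P%:P by exact: ev3C.
have eX : e 'X%:P%:P = 'X%:P%:P by exact: ev3X.
have eY : e 'X%:P = linP a b by exact: ev3Y.
have eZ : e 'X = s by exact: ev3Z.
have eP rho : e rho%:P = evP a b rho.
  rewrite /e /ev3 ev1C; apply: ev1_eq; apply: rmorph_ext => [c|].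
    exact: ev1C.
  exact: ev1X.
have De h : D (e h) = e (dz h).
  have DC (c : K) : D (e c%:P%:P%:P) = 0 by rewrite eC; exact: Dab_x.
  rewrite (chain3 hD DC) eX eY eZ Ds Dab_P (Dab_x a b 'X).
  exact: lin001.
have anti := antiderivative (natr_inv_poly (natr_inv_poly (natr_inv_field char0))).
move=> r; have [n] := nilp_Dab a b r; elim: n r => [|n IH] r.
  by move=> r0; exists 0; exact: etrans r0 (esym (rmorph0 e)).
rewrite iterSr => /IH[h eh]; have [H eH] := anti h.
have [rho erho] : exists rho, r - e H = evP a b rho.
  have DeH : D (e H) = e h by rewrite De dz.unlock eH.
  apply: kerD; apply: (addIr (D (e H))); rewrite add0r -DD subrK eh DeH.
  by [].
by exists (rho%:P + H); rewrite rmorphD eP -erho subrK.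
Qed.

End SliceGenerates.

Lemma coordinate_in_kernel (K : fieldType) (f : {poly K}) (g : {poly {poly K}})
    (u v w : {poly {poly {poly K}}}) :
  (forall k : nat, k.+1%:R != 0 :> K) -> f != 0 ->
  (forall r, exists h, r = ev3 (iC K) u v w h) ->
  f%:P%:P * dy u + g%:P * dz u = 0 -> ~ (dy u = 0 /\ dz u = 0) ->
  exists P s, f%:P%:P * dy P + g%:P * dz P = 0 /\
    forall r, exists h, r = ev3 (iC K) 'X%:P%:P P s h.
Proof.
move=> char0 fn gen ku nu.
pose Q n := exists (a : {poly K}) (b : {poly {poly K}}), [/\ a != 0, a%:P * g + f%:P * b^`() = 0 & size a = n].
(* The pair of [f] and a y-antiderivative of [- g] gives one kernel element, so one with [a] of
   least degree exists. *)
have [n [a [b [an hP sa]]] least] : exists2 n, Q n & forall k, Q k -> (n <= k)%N.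
  have [b hb] := antiderivative (natr_inv_poly (natr_inv_field char0)) (- g).
  by apply: (@nat_least Q (size f)); exists f, b; rewrite hb mulrN subrr.
have amin (a' : {poly K}) (b' : {poly {poly K}}) : a' != 0 -> a'%:P * g + f%:P * b'^`() = 0 -> (size a <= size a')%N.
  by move=> a'n h'; rewrite sa; apply: least; exists a', b'.
have hP3 : a%:P%:P * g%:P + f%:P%:P * (b^`())%:P = 0 :> {poly {poly {poly K}}}.
  by rewrite -!polyCM -polyCD hP polyC0.
(* By [hP], f times [Dab a b] equals a times f d/dy + g d/dz. *)
have Du : Dab a b u = 0.
  have fn3 : f%:P%:P != 0 :> {poly {poly {poly K}}} by rewrite !polyC_eq0.
  apply: (mulfI fn3); rewrite mulr0 DabE.
  move: (dy u) (dz u) (a%:P%:P) (f%:P%:P) (g%:P) ((b^`())%:P) ku hP3 => p q s t r m e1 e2.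
  have -> : t * (s * p - m * q) = s * (t * p + r * q) - q * (s * r + t * m) by ring.
  by rewrite e1 e2 !mulr0 subrr.
have kerD := kernel_generated char0 an hP amin.
have [s Ds] := slice_exists char0 an hP amin gen Du nu.
exists (linP a b), s; split; last exact: slice_generates.
have [yD yM] := ders_dy K; have [zD zM] := ders_dz K.
have eyP : dy (linP a b) = (b^`())%:P.
  rewrite /linP yD (ders_linear (ders_dy K) (dyCC a)) dyZ dyC mulr0 add0r //.
have ezP : dz (linP a b) = a%:P%:P.
  have h := ders_linear (ders_dz K) (dzC a%:P) 'X; rewrite dzZ mulr1 in h.
  exact: etrans (zD _ _) (etrans (congr2 +%R h (dzC _)) (addr0 _)).
rewrite eyP ezP addrC [g%:P * _]mulrC; exact: hP3.
Qed.

(** * Generators, rank and integration along a coordinate *)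

Lemma gen_eq0 (T : comNzRingType) (S : T -> Prop) (D : T -> T) xs :
  is_derivation S D -> (forall x, x \in xs -> D x = 0) -> forall b, gen S xs b -> D b = 0.
Proof.
move=> [DD DM DS] hx b; have hD : is_der id D by [].
elim=> [c /DS //|x /hx //|c d _ c0 _ d0|c _ c0|c d _ c0 _ d0].
- by rewrite DD c0 d0 addr0.
- by have := DD (- c) c; rewrite addNr (ders0 hD) c0 addr0 => <-.
- by rewrite DM c0 d0 !mulr0 addr0.
Qed.

Lemma gen_rank_le1 (R : comNzRingType) (D : {poly {poly {poly R}}} -> {poly {poly {poly R}}}) p q r :
  is_derivation (@inBase3 R) D -> D p = 0 -> D q = 0 ->
  (forall b, gen (@inBase3 R) [:: p; q; r] b) -> rank_le (@inBase3 R) 3 D 1.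
Proof.
move=> hD hp hq hg; exists [:: p; q; r]; split=> //.
by apply: gen_eq0 hD _ => x; rewrite !inE => /orP[] /eqP->.
Qed.

Section Generators.
Variable R : comNzRingType.
Notation B := {poly {poly {poly R}}}.
Notation S := (@inBase3 R).

Lemma gen_iC xs (c : R) : gen S xs (iC R c).
Proof. by apply: gen_base; exists c. Qed.

Lemma gen0P b : gen S [::] b -> exists c, b = iC R c.
Proof. by apply: gen_rmorph_im => // a [c ->]; exists c. Qed.

Lemma gen1P x b : gen S [:: x] b -> exists p, b = ev1 (iC R) x p.
Proof.
apply: gen_rmorph_im => [_ [c ->]|y]; first by exists c%:P; rewrite ev1C.
by rewrite inE => /eqP->; exists 'X; rewrite ev1X.
Qed.

Lemma gen2P x y b : gen S [:: x; y] b -> exists p, b = ev1 (ev1 (iC R) x) y p.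
Proof.
apply: gen_rmorph_im => [_ [c ->]|z]; first by exists c%:P%:P; rewrite !ev1C.
rewrite !inE => /orP[] /eqP->; first by exists 'X%:P; rewrite ev1C ev1X.
by exists 'X; rewrite ev1X.
Qed.

Lemma gen3P x y z b : gen S [:: x; y; z] b -> exists p, b = ev3 (iC R) x y z p.
Proof.
apply: gen_rmorph_im => [_ [c ->]|t]; first by exists c%:P%:P%:P; rewrite ev3C.
rewrite !inE => /orP[|/orP[]] /eqP->; first by exists 'X%:P%:P; rewrite ev3X.
  by exists 'X%:P; rewrite ev3Y.
by exists 'X; rewrite ev3Z.
Qed.

Lemma gen_ev3 x y z xs p : gen S xs x -> gen S xs y -> gen S xs z ->
  gen S xs (ev3 (iC R) x y z p).
Proof.
move=> hx hy hz; apply: gen_ev1 => // q; apply: gen_ev1 => // r; apply: gen_ev1 => //.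
exact: gen_iC.
Qed.

End Generators.

Lemma integrate (R T : comNzRingType) (h : {rmorphism R -> T}) (D : T -> T) t c c' :
  (forall k : nat, exists d : R, d * k.+1%:R = 1) ->
  is_der id D -> (forall x, D (h x) = 0) -> D t = h c -> c' * c = 1 ->
  forall r, exists k, D (ev1 h t k) = ev1 h t r.
Proof.
move=> nat hD Dh Dt cc r; have [k ek] := antiderivative nat (c'%:P * r).
exists k; rewrite (ders_ev1 _ _ hD Dh) ek Dt rmorphM ev1C mulrAC -rmorphM cc.
by rewrite rmorph1 mul1r.
Qed.

(** Subtract from y2, then from y3, an antiderivative along y1. The second integration takes K[P1]
    as its ring of constants, and the coordinates P1, P2, y1 remain. *)
Lemma constant_rank_le1 (K : fieldType) (D : {poly {poly {poly K}}} -> {poly {poly {poly K}}})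
    c y1 y2 y3 p2 p3 :
  (forall k : nat, k.+1%:R != 0 :> K) -> is_derivation (@inBase3 K) D ->
  (forall b, gen (@inBase3 K) [:: y1; y2; y3] b) -> c != 0 -> D y1 = iC K c ->
  D y2 = ev1 (iC K) y1 p2 -> D y3 = ev1 (ev1 (iC K) y1) y2 p3 ->
  rank_le (@inBase3 K) 3 D 1.
Proof.
move=> char0 hD hgen cn D1 D2 D3; have [DD DM DS] := hD; have hd : is_der id D by [].
have DN x : D (- x) = - D x.
  by apply/eqP; rewrite -addr_eq0 -DD addNr (ders0 hd).
have DC k : D (iC K k) = 0 := DS _ (ex_intro _ k (erefl _)).
have nat := natr_inv_field char0.
have cc : c^-1 * c = 1 by rewrite mulVf.
have [k1 e1] := integrate nat hd DC D1 cc p2.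
pose P1 : {poly {poly {poly K}}} := y2 - ev1 (iC K) y1 k1.
have DP1 : D P1 = 0 by rewrite DD DN D2 e1 subrr.
have DC1 q : D (ev1 (iC K) P1 q) = 0 by rewrite (ders_ev1 _ _ hd DC) DP1 mulr0.
have D1' : D y1 = ev1 (iC K) P1 c%:P by exact: etrans D1 (esym (ev1C _ _ _)).
have cc1 : c^-1%:P * c%:P = 1 :> {poly K} by rewrite -polyCM cc polyC1.
have genP1 : gen (@inBase3 K) [:: P1; y1] (D y3).
  have g1 : gen (@inBase3 K) [:: P1; y1] y1 by apply: gen_var; rewrite !inE eqxx orbT.
  rewrite D3; apply: gen_ev1 => [q|].
    by apply: gen_ev1 => // x; exact: gen_iC.
  rewrite -(subrK (ev1 (iC K) y1 k1) y2); apply: gen_add.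
    by apply: gen_var; rewrite inE eqxx.
  by apply: gen_ev1 => // x; exact: gen_iC.
have [q3 D3'] := gen2P genP1.
have [k2 e2] := integrate (natr_inv_poly nat) hd DC1 D1' cc1 q3.
pose P2 : {poly {poly {poly K}}} := y3 - ev1 (ev1 (iC K) P1) y1 k2.
have DP2 : D P2 = 0 by rewrite DD DN D3' e2 subrr.
apply: (gen_rank_le1 (r := y1) hD DP1 DP2) => b.
have gP1 : gen (@inBase3 K) [:: P1; P2; y1] P1 by apply: gen_var; rewrite !inE eqxx.
have gP2 : gen (@inBase3 K) [:: P1; P2; y1] P2 by apply: gen_var; rewrite !inE eqxx orbT.
have gy : gen (@inBase3 K) [:: P1; P2; y1] y1 by apply: gen_var; rewrite !inE eqxx !orbT.
apply: gen_sub (hgen b) => [x|x]; first exact: gen_base.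
rewrite !inE => /orP[/eqP->|/orP[]/eqP->] //.
  rewrite -(subrK (ev1 (iC K) y1 k1) y2); apply: gen_add => //.
  by apply: gen_ev1 => // z; exact: gen_iC.
rewrite -(subrK (ev1 (ev1 (iC K) P1) y1 k2) y3); apply: gen_add => //.
by apply: gen_ev1 => // z; apply: gen_ev1 => // z'; exact: gen_iC.
Qed.

(** * Kernel coordinates of triangular derivations *)

Lemma lin0 (R : comNzRingType) (x y z p q : R) : x * 0 + y * p + z * q = p * y + q * z.
Proof. by rewrite mulr0 add0r [y * p]mulrC [z * q]mulrC. Qed.

Lemma gen_mem3 (T : comNzRingType) (S : T -> Prop) x y z :
  gen S [:: x; y; z] x /\ gen S [:: x; y; z] y /\ gen S [:: x; y; z] z.
Proof. by split; [|split]; apply: gen_var; rewrite !inE eqxx ?orbT. Qed.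

Lemma ev3_inj (R : idomainType) (x y z : {poly {poly {poly R}}}) :
  (forall k : nat, k.+1%:R != 0 :> R) ->
  (forall r, exists h, r = ev3 (iC R) x y z h) ->
  injective (ev3 (iC R) x y z).
Proof.
move=> char0 hgen p q epq; apply/eqP; rewrite -subr_eq0; apply/eqP.
apply: (surj_endo_inj char0 _ hgen) => [c|]; first exact: ev3C.
by rewrite (rmorphB (ev3 (iC R) x y z)) epq subrr.
Qed.

(** Once D y1 = 0, the derivation is p2(x) d/dy + p3(x, y) d/dz in the coordinates y1, y2, y3. If p2
    is nonzero, a coordinate in its kernel outside K[x] yields a coordinate system with two members
    in the kernel. *)
Lemma triangular_kernel_coordinate (K : fieldType)
    (D : {poly {poly {poly K}}} -> {poly {poly {poly K}}})
    (y1 y2 y3 u v w : {poly {poly {poly K}}}) c p2 p3 :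
  (forall k : nat, k.+1%:R != 0 :> K) -> is_derivation (@inBase3 K) D ->
  (forall b, gen (@inBase3 K) [:: y1; y2; y3] b) ->
  (forall b, gen (@inBase3 K) [:: u; v; w] b) ->
  D y1 = iC K c -> D y2 = ev1 (iC K) y1 p2 -> D y3 = ev1 (ev1 (iC K) y1) y2 p3 ->
  D u = 0 -> ~ rank_le (@inBase3 K) 3 D 1 ->
  c = 0 /\ exists k, u = ev3 (iC K) y1 y2 y3 k%:P%:P.
Proof.
move=> char0 hD gy gu D1 D2 D3 Du nrank; have [DD DM DS] := hD; have hd : is_der id D by [].
have c0 : c = 0.
  by apply/eqP/negPn/negP => cn; apply: nrank; exact: (constant_rank_le1 char0 hD gy cn D1 D2 D3).
split=> //; rewrite c0 rmorph0 in D1.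
have DC k : D (iC K k) = 0 := DS _ (ex_intro _ k (erefl _)).
have sy r : exists h, r = ev3 (iC K) y1 y2 y3 h := gen3P (gy r).
have einj := ev3_inj char0 sy.
set e := ev3 (iC K) y1 y2 y3 in einj *.
have eC (k : K) : e k%:P%:P%:P = iC K k by exact: ev3C.
have eC' (k : K) : e (iC K k) = iC K k by exact: eC.
have eX : e 'X%:P%:P = y1 by exact: ev3X.
have eY : e 'X%:P = y2 by exact: ev3Y.
have eZ : e 'X = y3 by exact: ev3Z.
have ep2 : e p2%:P%:P = D y2 by rewrite D2; exact: etrans (ev1C _ _ _) (ev1C _ _ _).
have ep3 : e p3%:P = D y3 by rewrite D3; exact: ev1C.
have De h : D (e h) = e (p2%:P%:P * dy h + p3%:P * dz h).
  have DeC (k : K) : D (e k%:P%:P%:P) = 0 by rewrite eC; exact: DC.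
  rewrite (chain3 hd DeC) eX eY eZ D1 lin0 (rmorphD e) !(rmorphM e) ep2 ep3.
  by [].
have [f0|fn] := eqVneq p2 0.
  exfalso; apply: nrank; apply: (gen_rank_le1 (p := y1) (q := y2) (r := y3)) => //.
  by rewrite D2 f0; exact: rmorph0.
have [[u' eu] [[v' ev] [w' ew]]] := (sy u, (sy v, sy w)).
rewrite -/e in eu ev ew.
have su' r : exists h, r = ev3 (iC K) u' v' w' h.
  have [h eh] := gen3P (gu (e r)); exists h; apply: einj.
  by rewrite eh (ev3_comp (j := iC K) _ _ _ _ eC') -eu -ev -ew.
have ku' : p2%:P%:P * dy u' + p3%:P * dz u' = 0.
  by apply: einj; rewrite -De -eu Du (rmorph0 e).
have [[yu zu]|nu] := classic (dy u' = 0 /\ dz u' = 0).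
  have [k ek] := dydz_eq0 char0 yu zu.
  by exists k; exact: etrans eu (congr1 e ek).
have [P [s [kP sP]]] := coordinate_in_kernel char0 fn su' ku' nu.
exfalso; apply: nrank; apply: (gen_rank_le1 (p := y1) (q := e P) (r := e s)) => //.
  by rewrite De kP; exact: rmorph0.
move=> b; have [h ->] := sy b; have [h' ->] := sP h.
rewrite -/e (ev3_comp (j := iC K) _ _ _ _ eC') eX.
have [g1 [g2 g3]] := gen_mem3 (@inBase3 K) y1 (e P) (e s).
exact: gen_ev3.
Qed.

(* Differentiating x = kappa(y1) along y and z kills the y- and z-derivatives of y1. *)
Lemma coordinate_sub (R : idomainType) (x y z y1 y2 y3 : {poly {poly {poly R}}}) kappa :
  (forall k : nat, k.+1%:R != 0 :> R) ->
  (forall b, gen (@inBase3 R) [:: x; y; z] b) ->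
  (forall b, gen (@inBase3 R) [:: y1; y2; y3] b) ->
  x = ev1 (iC R) y1 kappa -> gen (@inBase3 R) [:: x] y1.
Proof.
move=> char0 gx gy ex.
have sx r : exists h, r = ev3 (iC R) x y z h := gen3P (gx r).
have sy r : exists h, r = ev3 (iC R) y1 y2 y3 h := gen3P (gy r).
have [injx injy] := (ev3_inj char0 sx, ev3_inj char0 sy).
have [m em] := sx y1.
set e := ev3 (iC R) x y z in em injx *.
have eC (k : R) : e (iC R k) = iC R k by exact: ev3C.
have eX : e 'X%:P%:P = x by exact: ev3X.
have ekm (q : {poly R}) : e (ev1 (iC R) m q) = ev1 (iC R) y1 q.
  by rewrite (ev1_comp _ eC) -em.
have xkm : 'X%:P%:P = ev1 (iC R) m kappa by apply: injx; rewrite ekm -ex eX.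
(* Otherwise kappa' = 0, so kappa would be constant, and x with it. *)
have kn : ev1 (iC R) m kappa^`() != 0.
  apply/negP => /eqP/(congr1 e); rewrite ekm (rmorph0 e) => k0.
  have /polyC_inj/polyC_inj/(deriv_eq0 char0) ek : kappa^`()%:P%:P = 0%:P%:P :> {poly {poly {poly R}}}.
    rewrite !polyC0; apply: injy; rewrite (rmorph0 (ev3 _ _ _ _)) -k0.
    exact: etrans (ev1C _ _ _) (ev1C _ _ _).
  have : dx ('X%:P%:P : {poly {poly {poly R}}}) = 0.
    by rewrite xkm ek ev1C; exact: dxCC.
  by rewrite dxX => /eqP; rewrite oner_eq0.
have dm d : is_der id d -> (forall k, d (iC R k) = 0) ->
    d ('X%:P%:P : {poly {poly {poly R}}}) = 0 -> d m = 0.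
  move=> hd dC; rewrite xkm (ders_ev1 _ _ hd dC) => /eqP.
  by rewrite mulf_eq0 (negbTE kn) => /eqP.
have yC (k : R) : dy (iC R k) = 0 by exact: dyCC.
have zC (k : R) : dz (iC R k) = 0 by exact: dzC.
have [k ek] := dydz_eq0 char0 (dm _ (ders_dy R) yC (dyCC _)) (dm _ (ders_dz R) zC (dzC _)).
have -> : y1 = ev1 (iC R) x k.
  by rewrite em ek; exact: etrans (ev1C _ _ _) (ev1C _ _ _).
by apply: gen_ev1 => [c|]; [exact: gen_iC|apply: gen_var; rewrite inE eqxx].
Qed.

(** * Passage from A to its fraction field *)

Lemma gen_bc3 (R S : comNzRingType) (i : {rmorphism R -> S}) (x y z : {poly {poly {poly R}}}) :
  (forall b, gen (@inBase3 R) [:: x; y; z] b) ->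
  forall b, gen (@inBase3 S) [:: bc3 i x; bc3 i y; bc3 i z] b.
Proof.
move=> hg b; have [h ->] := bc_gen i (fun r => gen3P (hg r)) b.
have [g1 [g2 g3]] := gen_mem3 (@inBase3 S) (bc3 i x) (bc3 i y) (bc3 i z).
exact: gen_ev3.
Qed.

Lemma bc3_iC (R S : comNzRingType) (i : {rmorphism R -> S}) c :
  bc3 i (iC R c) = iC S (i c).
Proof. by rewrite -[iC R c]/(c%:P%:P%:P) bc3C bc2C bc1C. Qed.

Lemma bc3_ev1 (R S : comNzRingType) (i : {rmorphism R -> S}) x p :
  bc3 i (ev1 (iC R) x p) = ev1 (iC S) (bc3 i x) (bc1 i p).
Proof.
rewrite (@ev1_comp _ _ _ _ _ _ (iC S \o i)) => [|c]; last exact: bc3_iC.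
exact/esym/ev1_map.
Qed.

Lemma bc3_ev2 (R S : comNzRingType) (i : {rmorphism R -> S}) x y p :
  bc3 i (ev1 (ev1 (iC R) x) y p) = ev1 (ev1 (iC S) (bc3 i x)) (bc3 i y) (bc2 i p).
Proof.
rewrite (@ev1_comp _ _ _ _ _ _ (ev1 (iC S) (bc3 i x) \o bc1 i)) => [|c]; last exact: bc3_ev1.
exact/esym/ev1_map.
Qed.

Lemma bc3_ev3 (R S : comNzRingType) (i : {rmorphism R -> S}) x y z p :
  bc3 i (ev3 (iC R) x y z p) = ev3 (iC S) (bc3 i x) (bc3 i y) (bc3 i z) (bc3 i p).
Proof.
rewrite /ev3 (@ev1_comp _ _ _ _ _ _ (ev1 (ev1 (iC S) (bc3 i x)) (bc3 i y) \o bc2 i)) => [|c].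
  exact/esym/ev1_map.
exact: bc3_ev2.
Qed.

Unset Implicit Arguments.

Theorem theorem1p3
  (A : idomainType)
  (hQ : forall k : nat, (k.+1)%:R \is a @GRing.unit A)
  (D : {poly {poly {poly A}}} -> {poly {poly {poly A}}})
  (hD : is_LND (@inBase3 A) D)
  (X Y Z : {poly {poly {poly A}}})
  (hXYZ : coord_sys (@inBase3 A) 3 [:: X; Y; Z])
  (hDX : D X = 0)
  (DK : {poly {poly {poly {fraction A}}}} -> {poly {poly {poly {fraction A}}}})
  (hDKder : is_derivation (@inBase3 {fraction A}) DK)
  (hDKext : forall b, DK (frac3 b) = frac3 (D b))
  (hrank : rank_eq (@inBase3 A) 3 D 2)
  (hrankK : rank_eq (@inBase3 {fraction A}) 3 DK 2) :
  triangulable (@inBase3 A) 3 D <->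
  triangulable (gen (@inBase3 A) [:: X]) 2 D.
Proof.
(* For the converse, prepend X, which [D] kills, to a system over A[X]. *)
split=> [[ys [[sz gY] tri]]|[ys [[sz gY] tri]]]; last first.
  case: ys sz gY tri => [|y1 [|y2 [|]]] // _ gY tri.
  exists [:: X; y1; y2]; split; first by split=> // b; apply/(gen_gen _ [:: X] [:: y1; y2]).
  case=> [|[|[|//]]] _ /=.
  - by rewrite hDX; apply: gen_base; exists 0; rewrite /cst3 !polyC0.
  - by apply/(gen_gen _ [:: X] [::]); exact: (tri 0%N).
  - by apply/(gen_gen _ [:: X] [:: y1]); exact: (tri 1%N).
case: ys sz gY tri => [|y1 [|y2 [|y3 [|]]]] // _ gY tri.
have [gX [_ nrK]] := (hXYZ.2, hrankK).
have {}nrK : ~ rank_le (@inBase3 {fraction A}) 3 DK 1 by apply: nrK.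
have t1 : gen (@inBase3 A) [::] (D y1) by exact: (tri 0%N).
have t2 : gen (@inBase3 A) [:: y1] (D y2) by exact: (tri 1%N).
have t3 : gen (@inBase3 A) [:: y1; y2] (D y3) by exact: (tri 2%N).
have [c e1] := gen0P t1; have [p2 e2] := gen1P t2; have [p3 e3] := gen2P t3.
pose K : fieldType := {fraction A}; pose fr : {rmorphism A -> K} := @tofrac A.
have char0 (k : nat) : k.+1%:R != 0 :> A.
  by apply: contraTneq (hQ k) => ->; rewrite unitr0.
have fr_inj : injective fr by move=> p q /eqP; rewrite tofrac_eq => /eqP.
have char0K (k : nat) : k.+1%:R != 0 :> K.
  by rewrite -(rmorph_nat fr) -(rmorph0 fr) (inj_eq fr_inj).
have bcD b : DK (bc3 fr b) = bc3 fr (D b) by exact: hDKext.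
have [k1 [k2 k3]] : [/\ DK (bc3 fr y1) = iC K (fr c),
    DK (bc3 fr y2) = ev1 (iC K) (bc3 fr y1) (bc1 fr p2) &
    DK (bc3 fr y3) = ev1 (ev1 (iC K) (bc3 fr y1)) (bc3 fr y2) (bc2 fr p3)].
  split; rewrite bcD.
  - by rewrite e1 bc3_iC.
  - by rewrite e2 bc3_ev1.
  - by rewrite e3 bc3_ev2.
have DKX : DK (bc3 fr X) = 0 by rewrite bcD hDX; exact: rmorph0.
have [fc0 [k ek]] := triangular_kernel_coordinate char0K hDKder (gen_bc3 fr gY) (gen_bc3 fr gX)
  k1 k2 k3 DKX nrK.
have sY r : exists h, r = ev3 (iC A) y1 y2 y3 h := gen3P (gY r).
have [h eh] := sY X.
have sYK r : exists h, r = ev3 (iC K) (bc3 fr y1) (bc3 fr y2) (bc3 fr y3) h :=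
  gen3P (gen_bc3 fr gY r).
(* Over [K] the polynomial expressing X in y1, y2, y3 involves x alone. Its y- and z-derivatives
   therefore vanish already over [A], where X becomes kappa(y1). *)
have hk : bc3 fr h = k%:P%:P.
  by apply: (ev3_inj char0K sYK); rewrite -bc3_ev3 -eh.
have bc_inj := bc3_inj fr_inj.
have dyh : dy h = 0 by apply: bc_inj; rewrite bc3_dy hk dyCC; exact/esym/rmorph0.
have dzh : dz h = 0 by apply: bc_inj; rewrite bc3_dz hk dzC; exact/esym/rmorph0.
have [kappa ekappa] := dydz_eq0 char0 dyh dzh.
have eX : X = ev1 (iC A) y1 kappa.
  by rewrite eh ekappa; exact: etrans (ev1C _ _ _) (ev1C _ _ _).
have y1X : gen (@inBase3 A) [:: X] y1 := coordinate_sub char0 gX gY eX.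
(* Since y1 lies in A[X], the elements y2, y3 form a triangular system over A[X]. *)
exists [:: y2; y3]; split.
  split=> // b; apply/gen_gen; apply: gen_sub (gY b) => [a|x]; first exact: gen_base.
  rewrite inE => /orP[/eqP->|hx]; last by apply: gen_var; rewrite inE hx orbT.
  apply: gen_sub y1X => [a|x']; first exact: gen_base.
  by rewrite inE => /eqP->; apply: gen_var; rewrite inE eqxx.
case=> [|[|//]] _ /=.
  apply: gen_base; apply: gen_sub t2 => [a|x]; first exact: gen_base.
  by rewrite inE => /eqP->.
apply/gen_gen; apply: gen_sub t3 => [a|x]; first exact: gen_base.
rewrite inE => /orP[/eqP->|hx]; last by apply: gen_var; rewrite inE hx orbT.
apply: gen_sub y1X => [a|x']; first exact: gen_base.
by rewrite inE => /eqP->; apply: gen_var; rewrite inE eqxx.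
Qed.
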